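(* Let $R\subseteq S$ be a Prüfer (respectively, quasi-Prüfer) extension and $R\to T$ an absolutely flat ring morphism. Then $T\to T\otimes_R S$ is a Prüfer (respectively, quasi-Prüfer) extension.
   Context: All rings are commutative with identity. A ring morphism $R\to T$ is absolutely flat if both $R\to T$ and the multiplication map $T\otimes_R T\to T$ are flat. For an extension $A\subseteq B$, $[A,B]$ is the set of $A$-subalgebras of $B$. $A\subseteq B$ is Prüfer if $A\subseteq U$ is a flat epimorphism (flat and an epimorphism of commutative rings) for every $U\in[A,B]$; $A\subseteq B$ is quasi-Prüfer if $\overline A\subseteq B$ is Prüfer, where $\overline A$ is the integral closure of $A$ in $B$. *)

(* Defs.v *)
(* Commutative rings are comPzRingType (zero ring allowed). *)
From HB Require Import structures.
From mathcomp Require Import all_boot all_algebra.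
Set Implicit Arguments. Unset Strict Implicit. Unset Printing Implicit Defensive.
Import GRing.Theory.
Local Open Scope ring_scope.

Definition balanced (A B : comPzRingType) (phi : {rmorphism A -> B})
    (N P : lmodType A) (b : N -> B -> P) : Prop :=
  [/\ forall n1 n2 x, b (n1 + n2) x = b n1 x + b n2 x,
      forall n x1 x2, b n (x1 + x2) = b n x1 + b n x2,
      forall a n x, b (a *: n) x = a *: b n x
    & forall a n x, b n (phi a * x) = a *: b n x].

Definition is_tensor (A B : comPzRingType) (phi : {rmorphism A -> B})
    (N P : lmodType A) (b : N -> B -> P) : Prop :=
  balanced phi b /\
  forall (Q : lmodType A) (c : N -> B -> Q), balanced phi c ->
    (exists g : {linear P -> Q}, forall n x, g (b n x) = c n x) /\
    (forall g1 g2 : {linear P -> Q},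
        (forall n x, g1 (b n x) = c n x) ->
        (forall n x, g2 (b n x) = c n x) -> g1 =1 g2).

Definition flat_morphism (A B : comPzRingType) (phi : {rmorphism A -> B}) : Prop :=
  forall (N N' : lmodType A) (f : {linear N -> N'}), injective f ->
  forall (P P' : lmodType A) (b : N -> B -> P) (b' : N' -> B -> P'),
    is_tensor phi b -> is_tensor phi b' ->
    forall g : {linear P -> P'}, (forall n x, g (b n x) = b' (f n) x) ->
    injective g.

Definition ring_epimorphism (A B : comPzRingType) (phi : {rmorphism A -> B}) : Prop :=
  forall (C : comPzRingType) (g h : {rmorphism B -> C}),
    (forall a, g (phi a) = h (phi a)) -> g =1 h.

Definition flat_epimorphism (A B : comPzRingType) (phi : {rmorphism A -> B}) : Prop :=
  flat_morphism phi /\ ring_epimorphism phi.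

Definition is_ring_tensor (R T S P : comPzRingType)
    (f : {rmorphism R -> T}) (g : {rmorphism R -> S})
    (i : {rmorphism T -> P}) (j : {rmorphism S -> P}) : Prop :=
  (forall r, i (f r) = j (g r)) /\
  forall (C : comPzRingType) (i' : {rmorphism T -> C}) (j' : {rmorphism S -> C}),
    (forall r, i' (f r) = j' (g r)) ->
    (exists h : {rmorphism P -> C}, (forall t, h (i t) = i' t) /\ (forall s, h (j s) = j' s)) /\
    (forall h1 h2 : {rmorphism P -> C},
       (forall t, h1 (i t) = i' t) -> (forall s, h1 (j s) = j' s) ->
       (forall t, h2 (i t) = i' t) -> (forall s, h2 (j s) = j' s) -> h1 =1 h2).

Definition absolutely_flat (R T : comPzRingType) (f : {rmorphism R -> T}) : Prop :=
  flat_morphism f /\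
  forall (Q : comPzRingType) (i1 i2 : {rmorphism T -> Q}),
    is_ring_tensor f f i1 i2 ->
    forall m : {rmorphism Q -> T},
      (forall t, m (i1 t) = t) -> (forall t, m (i2 t) = t) -> flat_morphism m.

(* An extension A \subseteq B is an injective ring morphism phi : A -> B.
   The elements U of [A,B] are represented (up to isomorphism) by rings U with
   an injective morphism u : U -> B whose image contains phi(A); a : A -> U is
   the induced inclusion. *)
Definition prufer (A B : comPzRingType) (phi : {rmorphism A -> B}) : Prop :=
  injective phi /\
  forall (U : comPzRingType) (u : {rmorphism U -> B}) (a : {rmorphism A -> U}),
    injective u -> (forall x, u (a x) = phi x) -> flat_epimorphism a.

Definition integral_over (A B : comPzRingType) (phi : {rmorphism A -> B}) (y : B) : Prop :=
  exists (n : nat) (c : 'I_n -> A), y ^+ n + \sum_(k < n) phi (c k) * y ^+ k = 0.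

Definition quasi_prufer (A B : comPzRingType) (phi : {rmorphism A -> B}) : Prop :=
  injective phi /\
  forall (Abar : comPzRingType) (j : {rmorphism Abar -> B}) (k : {rmorphism A -> Abar}),
    injective j -> (forall x, j (k x) = phi x) ->
    (forall y, (exists z, j z = y) <-> integral_over phi y) ->
    prufer j.

(* Main.v *)
Require Import Defs.
From HB Require Import structures.
From mathcomp Require Import all_boot all_algebra.
From mathcomp Require Import boolp.

(** Everything is reduced to linear relations. Flatness of [A -> B] means that
    every [A]-linear relation between elements of [B] is a [B]-combination of
    relations between scalars, and a Prüfer extension [A] of [S] is one in which
    every module [A + A x] is invertible; then so is every finitely generated
    [A]-submodule of [S] that generates the unit ideal of [S].

    Let [U] lie between [T] and [P = T (x)_R S]. A relation over [R] between
    elements of [U] is trivial in [P], and [P / U] is torsion, so invertibility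
    of ideals lets one replace the elements of [P] by elements of [U]: [U] is
    [R]-flat. Flatness of [T (x)_R T -> T] gives elements [w] of [T (x)_R T] of
    multiplication 1 killed by any given [t (x) 1 - 1 (x) t], and multiplying a
    [T]-relation in [U] by [w] turns it into a relation in [T (x)_R U], so [U]
    is [T]-flat. Trivializing the relations [a u = t], with [a] ranging over
    denominators of [u], shows that [T -> U] is an epimorphism.

    In the quasi-Prüfer case the same argument is applied to the integral closure
    [B] of [R] in [S]: the image of [T (x)_R B] in [P] is Prüfer in [P], hence
    integrally closed, hence it is the integral closure of [T]. *)

Set Implicit Arguments. Unset Strict Implicit. Unset Printing Implicit Defensive.
Import GRing.Theory.
Local Open Scope ring_scope.

(** * Tensor products of modules *)

Section FormalSums.
Variables (K : eqType) (M : zmodType).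
Implicit Types s : seq (K * M).

Definition fcoef s (x : K) : M := \sum_(p <- s | p.1 == x) p.2.

Lemma fcoef_cat s s' x : fcoef (s ++ s') x = fcoef s x + fcoef s' x.
Proof. by rewrite /fcoef big_cat. Qed.

Lemma fcoef_cons p s x : fcoef (p :: s) x = (if p.1 == x then p.2 else 0) + fcoef s x.
Proof. by rewrite /fcoef big_cons; case: ifP; rewrite ?add0r. Qed.

Lemma fcoef_nil x : fcoef [::] x = 0.
Proof. exact: big_nil. Qed.

(** Terms are grouped by first component. Any duplicate-free [D] containing the support is allowed,
    so that several formal sums can be expanded over one common list. *)
Lemma fcoef_sum (V : zmodType) (b : K -> M -> V) s (D : seq K) :
  (forall x, {morph b x : m m' / m + m'}) ->
  uniq D -> {subset map fst s <= D} ->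
  \sum_(p <- s) b p.1 p.2 = \sum_(x <- D) b x (fcoef s x).
Proof.
move=> badd uD sD.
have b0 x : b x 0 = 0 by apply: (addrI (b x 0)); rewrite -badd !addr0.
under [RHS]eq_bigr => x _ do rewrite (big_morph _ (badd x) (b0 x)) big_mkcond.
rewrite exchange_big /=; apply: eq_big_seq => p ps.
rewrite (bigD1_seq p.1) ?eqxx //=; last by rewrite sD // map_f.
by rewrite big1 ?addr0 // => x /negPf; rewrite eq_sym => ->.
Qed.

End FormalSums.

Section Tensor.
Local Open Scope quotient_scope.
Variables (A B : comPzRingType) (phi : {rmorphism A -> B}) (N : lmodType A).
Implicit Types (h : N -> B) (s : seq (N * B)).

(* [h], of finite support, is the formal sum of the [n (x) h n]; the vanishing
   sums are the [B]-combinations of the [A]-linear relations of [N]. *)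
Definition tnull h : Prop :=
  exists (J : finType) (v : J -> B) (rho : J -> seq (N * A)),
    (forall j, \sum_(p <- rho j) p.2 *: p.1 = 0) /\
    (forall x, h x = \sum_j phi (fcoef (rho j) x) * v j).

Lemma tnull0 h : h =1 (fun=> 0) -> tnull h.
Proof.
by move=> h0; exists void, (fun=> 0), (fun=> [::]); split=> // x;
  rewrite h0 big1 // => -[].
Qed.

Lemma tnullD h1 h2 h : tnull h1 -> tnull h2 ->
  (forall x, h x = h1 x + h2 x) -> tnull h.
Proof.
move=> [J1 [v1 [r1 [z1 e1]]]] [J2 [v2 [r2 [z2 e2]]]] e.
exists (J1 + J2)%type, (fun j => match j with inl j => v1 j | inr j => v2 j end),
  (fun j => match j with inl j => r1 j | inr j => r2 j end).
by split=> [[]//|x]; rewrite e e1 e2 big_sumType.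
Qed.

Lemma tnullM h1 b h : tnull h1 -> (forall x, h x = h1 x * b) -> tnull h.
Proof.
move=> [J [v [r [z e1]]]] e; exists J, (fun j => v j * b), r; split=> // x.
by rewrite e e1 mulr_suml; apply: eq_bigr => j _; rewrite mulrA.
Qed.

Lemma tnull1 (r : seq (N * A)) b h : \sum_(p <- r) p.2 *: p.1 = 0 ->
  (forall x, h x = phi (fcoef r x) * b) -> tnull h.
Proof.
move=> r0 e; exists unit, (fun=> b), (fun=> r); split=> // x.
by rewrite e (bigD1 tt) //= big1 ?addr0 // => -[].
Qed.

(** Comparing coefficient functions absorbs reordering and merging of terms. Classical decidability
    makes the relation boolean, as the quotient type requires. *)
Definition tens_equiv s s' := `[< tnull (fun x => fcoef s x - fcoef s' x) >].

Lemma tens_equivP s s' :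
  reflect (tnull (fun x => fcoef s x - fcoef s' x)) (tens_equiv s s').
Proof. exact: asboolP. Qed.

Lemma tens_equiv_refl : reflexive tens_equiv.
Proof. by move=> s; apply/tens_equivP/tnull0 => x; rewrite subrr. Qed.

Lemma tens_equiv_sym : symmetric tens_equiv.
Proof.
move=> s s'; apply/tens_equivP/tens_equivP => /(tnullM (b := -1)); apply=> x;
  by rewrite mulrN1 opprB.
Qed.

Lemma tens_equiv_trans : transitive tens_equiv.
Proof.
move=> s' s s'' /tens_equivP h1 /tens_equivP h2; apply/tens_equivP.
by apply: (tnullD h1 h2) => x; rewrite addrA subrK.
Qed.

Canonical tens_equiv_rel :=
  EquivRel tens_equiv tens_equiv_refl tens_equiv_sym tens_equiv_trans.

Definition tensor := {eq_quot tens_equiv}.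
HB.instance Definition _ := Choice.on tensor.
HB.instance Definition _ := EqQuotient.on tensor.

Definition tadd (z w : tensor) : tensor := \pi_tensor (repr z ++ repr w).
(** The action of [B] on the second factor; the scaling by [A] is its restriction along [phi], and
    the opposite is its value at -1. *)
Definition tscaleB (b : B) (z : tensor) : tensor :=
  \pi_tensor [seq (p.1, p.2 * b) | p <- repr z].
Definition tzero : tensor := \pi_tensor [::].
Definition tens (n : N) (b : B) : tensor := \pi_tensor [:: (n, b)].

Lemma pi_eqP s s' : tnull (fun x => fcoef s x - fcoef s' x) ->
  \pi_tensor s = \pi_tensor s'.
Proof. by move=> H; apply/eqmodP/tens_equivP. Qed.

Lemma pi_eqE s s' : \pi_tensor s = \pi_tensor s' ->
  tnull (fun x => fcoef s x - fcoef s' x).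
Proof. by move/eqmodP/tens_equivP. Qed.

Lemma repr_piP s : tnull (fun x => fcoef (repr (\pi_tensor s)) x - fcoef s x).
Proof. by apply: pi_eqE; rewrite reprK. Qed.

Lemma fcoef_mulr s b x : fcoef [seq (p.1, p.2 * b) | p <- s] x = fcoef s x * b.
Proof. by rewrite /fcoef big_map mulr_suml. Qed.

Lemma tadd_pi s s' : tadd (\pi_tensor s) (\pi_tensor s') = \pi_tensor (s ++ s').
Proof.
apply: pi_eqP; apply: (tnullD (repr_piP s) (repr_piP s')) => x.
by rewrite !fcoef_cat opprD addrACA.
Qed.

Lemma tscaleB_pi b s : tscaleB b (\pi_tensor s) = \pi_tensor [seq (p.1, p.2 * b) | p <- s].
Proof.
apply: pi_eqP; apply: (tnullM (b := b) (repr_piP s)) => x.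
by rewrite !fcoef_mulr mulrBl.
Qed.

Lemma tensor_piP (z : tensor) : exists s, z = \pi_tensor s.
Proof. by exists (repr z); rewrite reprK. Qed.

Lemma pi_eq_fcoef s s' : fcoef s =1 fcoef s' -> \pi_tensor s = \pi_tensor s'.
Proof. by move=> e; apply/pi_eqP/tnull0 => x; rewrite e subrr. Qed.

Lemma taddA : associative tadd.
Proof.
move=> z w y; have [s ->] := tensor_piP z; have [s' ->] := tensor_piP w.
by have [s'' ->] := tensor_piP y; rewrite !tadd_pi catA.
Qed.

Lemma taddC : commutative tadd.
Proof.
move=> z w; have [s ->] := tensor_piP z; have [s' ->] := tensor_piP w.
by rewrite !tadd_pi; apply: pi_eq_fcoef => x; rewrite !fcoef_cat addrC.
Qed.

Lemma tadd0 : left_id tzero tadd.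
Proof. by move=> z; have [s ->] := tensor_piP z; rewrite tadd_pi. Qed.

Lemma taddN : left_inverse tzero (tscaleB (-1)) tadd.
Proof.
move=> z; have [s ->] := tensor_piP z; rewrite tscaleB_pi tadd_pi.
by apply: pi_eq_fcoef => x; rewrite fcoef_cat fcoef_mulr mulrN1 addNr fcoef_nil.
Qed.

HB.instance Definition _ := GRing.isZmodule.Build tensor taddA taddC tadd0 taddN.

Definition tscale (a : A) : tensor -> tensor := tscaleB (phi a).

Lemma tscaleBA b b' z : tscaleB b (tscaleB b' z) = tscaleB (b * b') z.
Proof.
have [s ->] := tensor_piP z; rewrite !tscaleB_pi; apply: pi_eq_fcoef => x.
by rewrite !fcoef_mulr -mulrA [b' * b]mulrC.
Qed.

Lemma tscaleB1 z : tscaleB 1 z = z.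
Proof.
have [s ->] := tensor_piP z; rewrite !tscaleB_pi; apply: pi_eq_fcoef => x.
by rewrite !fcoef_mulr mulr1.
Qed.

Lemma tscaleBDr b : {morph tscaleB b : z w / z + w}.
Proof.
move=> z w; have [s ->] := tensor_piP z; have [s' ->] := tensor_piP w.
rewrite [\pi_tensor s + \pi_tensor s']tadd_pi !tscaleB_pi [RHS]tadd_pi.
by apply: pi_eq_fcoef => x; rewrite fcoef_cat !fcoef_mulr fcoef_cat mulrDl.
Qed.

Lemma tscaleBDl z : {morph tscaleB^~ z : b b' / b + b'}.
Proof.
move=> b b'; have [s ->] := tensor_piP z.
rewrite !tscaleB_pi [RHS]tadd_pi.
by apply: pi_eq_fcoef => x; rewrite fcoef_cat !fcoef_mulr mulrDr.
Qed.

Fact tscaleA a b z : tscale a (tscale b z) = tscale (a * b) z.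
Proof. by rewrite /tscale tscaleBA rmorphM. Qed.
Fact tscale1 : left_id 1 tscale.
Proof. by move=> z; rewrite /tscale rmorph1 tscaleB1. Qed.
Fact tscaleDr : right_distributive tscale +%R.
Proof. by move=> a z w; rewrite /tscale tscaleBDr. Qed.
Fact tscaleDl z : {morph tscale^~ z : a b / a + b}.
Proof. by move=> a b; rewrite /tscale rmorphD tscaleBDl. Qed.

HB.instance Definition _ :=
  GRing.Zmodule_isLmodule.Build A tensor tscaleA tscale1 tscaleDr tscaleDl.

Lemma pi_tens s : \pi_tensor s = \sum_(p <- s) tens p.1 p.2.
Proof.
elim: s => [|[n b] s IH]; first by rewrite big_nil.
by rewrite big_cons -IH /= /tens [RHS]tadd_pi.
Qed.

Lemma tensorP (z : tensor) : exists s, z = \sum_(p <- s) tens p.1 p.2.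
Proof. by have [s ->] := tensor_piP z; exists s; rewrite pi_tens. Qed.

(** This is the gain of the concrete model over the universal property: a vanishing sum comes with
    explicit relations that account for it. *)
Lemma tens_sum_eq0 s : \sum_(p <- s) tens p.1 p.2 = 0 -> tnull (fcoef s).
Proof.
rewrite -pi_tens => /(@pi_eqE s [::]) H; apply: (tnullD H (tnull0 (h := fun=> 0) _)) => // x.
by rewrite fcoef_nil subr0 addr0.
Qed.

Lemma tensDr n : {morph tens n : b b' / b + b'}.
Proof.
move=> b b'; rewrite /tens [RHS]tadd_pi; apply: pi_eq_fcoef => x /=.
by rewrite !fcoef_cons fcoef_nil /=; case: ifP; rewrite !(addr0, addrA).
Qed.

Lemma tensZ a n b : tens (a *: n) b = tens n (phi a * b).
Proof.
(* The difference is [b] times the relation [1 *: (a *: n) - a *: n = 0] of [N]; additivity below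
   comes from a three-term relation in the same way. *)
apply: pi_eqP; apply: (tnull1 (r := [:: (a *: n, 1); (n, - a)]) (b := b)) => [|x].
  by rewrite !big_cons big_nil /= scale1r scaleNr addr0 subrr.
rewrite !fcoef_cons !fcoef_nil /= !addr0 rmorphD mulrDl.
by do 2!case: ifP => _; rewrite ?(rmorph0, rmorph1, mul0r, mul1r, rmorphN, mulNr, oppr0).
Qed.

Lemma tensDl b : {morph tens^~ b : n n' / n + n'}.
Proof.
move=> n n'; rewrite [RHS]tadd_pi; apply: pi_eqP.
apply: (tnull1 (r := [:: (n + n', 1); (n, - 1); (n', -1)]) (b := b)) => [|x].
  by rewrite !big_cons big_nil /= scale1r !scaleN1r addr0 -opprD subrr.
rewrite !fcoef_cons !fcoef_nil /= !addr0 !rmorphD !mulrDl opprD.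
by do 3!case: ifP => _; rewrite ?(rmorph0, rmorph1, mul0r, mul1r, rmorphN, mulNr, oppr0).
Qed.

Lemma scale_tens a n b : a *: tens n b = tens n (phi a * b).
Proof. by rewrite [LHS]tscaleB_pi /= mulrC. Qed.

Section Universal.
Variables (V : zmodType) (beta : N -> B -> V).
Hypothesis betaDl : forall n n' b, beta (n + n') b = beta n b + beta n' b.
Hypothesis betaDr : forall n b b', beta n (b + b') = beta n b + beta n b'.
Hypothesis betaA : forall a n b, beta (a *: n) b = beta n (phi a * b).

Definition tlift (z : tensor) : V := \sum_(p <- repr z) beta p.1 p.2.

Let beta0l b : beta 0 b = 0.
Proof. by apply: (addrI (beta 0 b)); rewrite -betaDl !addr0. Qed.
Let beta0r n : beta n 0 = 0.
Proof. by apply: (addrI (beta n 0)); rewrite -betaDr !addr0. Qed.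

(** Expanded over a common support and summed first over that support, the left side becomes a sum
    over [j] of values of [beta] at a relation [rho j] evaluated in [N], which is 0, and [v j]. *)
Lemma beta_null s : tnull (fcoef s) -> \sum_(p <- s) beta p.1 p.2 = 0.
Proof.
move=> [J [v [rho [z e]]]].
pose D := undup (map fst s ++ flatten [seq map fst (rho j) | j <- enum J]).
have uD : uniq D by exact: undup_uniq.
have sD : {subset map fst s <= D} by move=> x xs; rewrite mem_undup mem_cat xs.
have rD j : {subset map fst (rho j) <= D}.
  move=> x xs; rewrite mem_undup mem_cat; apply/orP; right.
  by apply/flatten_mapP; exists j; rewrite ?mem_enum.
rewrite (fcoef_sum betaDr uD sD).
under eq_bigr => x _ do rewrite e (big_morph _ (betaDr x) (beta0r x)).
rewrite exchange_big big1 // => j _ /=.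
under eq_bigr => x _ do rewrite -betaA.
rewrite -(big_morph (beta^~ (v j)) (fun n n' => betaDl n n' (v j)) (beta0l (v j))).
by rewrite -(fcoef_sum (b := fun x a => a *: x) _ uD (rD j)) ?z // => x a a'; rewrite scalerDl.
Qed.

Lemma tlift_pi s : tlift (\pi_tensor s) = \sum_(p <- s) beta p.1 p.2.
Proof.
apply/eqP; rewrite -subr_eq0 /tlift; apply/eqP.
have -> : - (\sum_(p <- s) beta p.1 p.2) =
    \sum_(p <- [seq (p.1, p.2 * -1) | p <- s]) beta p.1 p.2.
  rewrite big_map -sumrN; apply: eq_bigr => p _ /=; apply/eqP.
  by rewrite eq_sym -addr_eq0 -betaDr mulrN1 addNr beta0r.
rewrite -big_cat /=; apply: beta_null.
apply: (tnullD (repr_piP s) (tnull0 (h := fun=> 0) _)) => // x.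
by rewrite addr0 fcoef_cat fcoef_mulr mulrN1.
Qed.

Lemma tlift_tens n b : tlift (tens n b) = beta n b.
Proof. by rewrite tlift_pi big_seq1. Qed.

Lemma tliftD : {morph tlift : z w / z + w}.
Proof.
move=> z w; have [s ->] := tensor_piP z; have [s' ->] := tensor_piP w.
by rewrite [\pi_tensor s + \pi_tensor s']tadd_pi !tlift_pi big_cat.
Qed.

End Universal.

Lemma tensor_ext (V : zmodType) (f g : tensor -> V) :
  {morph f : z w / z + w} -> {morph g : z w / z + w} ->
  (forall n b, f (tens n b) = g (tens n b)) -> f =1 g.
Proof.
move=> fD gD e z; have [s ->] := tensorP z.
have f0 : f 0 = 0 by apply: (addrI (f 0)); rewrite -fD !addr0.
have g0 : g 0 = 0 by apply: (addrI (g 0)); rewrite -gD !addr0.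
by rewrite (big_morph f fD f0) (big_morph g gD g0); apply: eq_bigr.
Qed.

Lemma tens_balanced : balanced phi tens.
Proof.
split=> *; [exact: tensDl | exact: tensDr | | ].
  by rewrite tensZ scale_tens.
by rewrite scale_tens.
Qed.

Lemma balanced_lift (Q : lmodType A) (c : N -> B -> Q) : balanced phi c ->
  exists g : {linear tensor -> Q}, forall n b, g (tens n b) = c n b.
Proof.
move=> [cl cr ca cb].
have cA a n b : c (a *: n) b = c n (phi a * b) by rewrite ca cb.
have gD := tliftD cl cr cA; have gt := tlift_tens cl cr cA.
have glin : linear (tlift c).
  move=> a z w; rewrite gD; congr (_ + _); move: z.
  apply: tensor_ext => [z z'|z z'|n b].
  - by rewrite scalerDr gD.
  - by rewrite gD scalerDr.
  - by rewrite scale_tens !gt cb.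
pose m := GRing.isLinear.Build _ _ _ _ (tlift c) glin.
pose G : {linear tensor -> Q} := HB.pack (tlift c) m.
by exists G.
Qed.

Lemma tens_is_tensor : is_tensor phi tens.
Proof.
split=> [|Q c cb]; first exact: tens_balanced.
split; first exact: balanced_lift.
move=> g1 g2 e1 e2; apply: tensor_ext => [||n b]; try exact: raddfD.
by rewrite e1 e2.
Qed.

End Tensor.

(** * Tensor products of rings *)

(** A synonym of [C] that carries [psi], so that the [A]-module structure obtained by restriction of
    scalars is determined by the type. *)
Definition restr (A C : comPzRingType) (psi : {rmorphism A -> C}) : Type := C.

Section Restr.
Variables (A C : comPzRingType) (psi : {rmorphism A -> C}).
HB.instance Definition _ := GRing.Zmodule.on (restr psi).
Definition restr_scale (a : A) (c : restr psi) : restr psi := psi a * (c : C).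
Fact restr_scaleA a b c : restr_scale a (restr_scale b c) = restr_scale (a * b) c.
Proof. by rewrite /restr_scale rmorphM mulrA. Qed.
Fact restr_scale1 : left_id 1 restr_scale.
Proof. by move=> c; rewrite /restr_scale rmorph1 mul1r. Qed.
Fact restr_scaleDr : right_distributive restr_scale +%R.
Proof. by move=> a c d; rewrite /restr_scale mulrDr. Qed.
Fact restr_scaleDl c : {morph restr_scale^~ c : a b / a + b}.
Proof. by move=> a b; rewrite /restr_scale rmorphD mulrDl. Qed.
HB.instance Definition _ := GRing.Zmodule_isLmodule.Build A (restr psi)
  restr_scaleA restr_scale1 restr_scaleDr restr_scaleDl.
Lemma restr_scaleE (a : A) (c : restr psi) : a *: c = psi a * (c : C).
Proof. by []. Qed.
End Restr.

Section RingTensor.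
Variables (R T S : comPzRingType) (f : {rmorphism R -> T}) (g : {rmorphism R -> S}).

Definition rtensor : Type := tensor f (restr g).
HB.instance Definition _ := GRing.Zmodule.on rtensor.

Definition rtens (s : S) (t : T) : rtensor := tens f (s : restr g) t.

Lemma rtensDl t s s' : rtens (s + s') t = rtens s t + rtens s' t.
Proof. exact: tensDl. Qed.
Lemma rtensDr s t t' : rtens s (t + t') = rtens s t + rtens s t'.
Proof. exact: tensDr. Qed.
Lemma rtensZ a s t : rtens (g a * s) t = rtens s (f a * t).
Proof. exact: (tensZ f a (s : restr g) t). Qed.

Definition rtlift (V : zmodType) (beta : S -> T -> V) (z : rtensor) : V :=
  tlift (N := restr g) beta z.

Section Lift.
Variables (V : zmodType) (beta : S -> T -> V).
Hypothesis betaDl : forall s s' t, beta (s + s') t = beta s t + beta s' t.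
Hypothesis betaDr : forall s t t', beta s (t + t') = beta s t + beta s t'.
Hypothesis betaA : forall a s t, beta (g a * s) t = beta s (f a * t).

Lemma rtlift_tens s t : rtlift beta (rtens s t) = beta s t.
Proof. exact: (tlift_tens (phi := f) (N := restr g)). Qed.
Lemma rtliftD : {morph rtlift beta : z w / z + w}.
Proof. exact: (tliftD (phi := f) (N := restr g)). Qed.
End Lift.

Lemma rtensor_ext (V : zmodType) (h k : rtensor -> V) :
  {morph h : z w / z + w} -> {morph k : z w / z + w} ->
  (forall s t, h (rtens s t) = k (rtens s t)) -> h =1 k.
Proof. exact: (tensor_ext (phi := f) (N := restr g)). Qed.

Lemma rtensorP (z : rtensor) : exists l : seq (S * T), z = \sum_(p <- l) rtens p.1 p.2.
Proof. exact: (tensorP (phi := f) (N := restr g)). Qed.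

(** Multiplication by one pure tensor. The product [rmul] is a second lift, in the first factor; the
    ring laws are then checked on pure tensors by [rtensor_ext]. *)
Definition rmul1 (s : S) (t : T) : rtensor -> rtensor :=
  rtlift (fun s' t' => rtens (s * s') (t * t')).

Lemma rmul1_tens s t s' t' : rmul1 s t (rtens s' t') = rtens (s * s') (t * t').
Proof.
apply: rtlift_tens => *; rewrite ?mulrDr ?rtensDl ?rtensDr //.
by rewrite mulrCA rtensZ mulrCA.
Qed.

Lemma rmul1D s t : {morph rmul1 s t : z w / z + w}.
Proof.
apply: rtliftD => *; rewrite ?mulrDr ?rtensDl ?rtensDr //.
by rewrite mulrCA rtensZ mulrCA.
Qed.

Definition rmul (z w : rtensor) : rtensor := rtlift (fun s t => rmul1 s t w) z.

Section rmul_w.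
Variable w : rtensor.
Let L s s' t : rmul1 (s + s') t w = rmul1 s t w + rmul1 s' t w.
Proof.
move: w; apply: rtensor_ext => [||s1 t1]; first exact: rmul1D.
  by move=> z z'; rewrite !rmul1D addrACA.
by rewrite !rmul1_tens mulrDl rtensDl.
Qed.
Let M s t t' : rmul1 s (t + t') w = rmul1 s t w + rmul1 s t' w.
Proof.
move: w; apply: rtensor_ext => [||s1 t1]; first exact: rmul1D.
  by move=> z z'; rewrite !rmul1D addrACA.
by rewrite !rmul1_tens mulrDl rtensDr.
Qed.
Let Z a s t : rmul1 (g a * s) t w = rmul1 s (f a * t) w.
Proof.
move: w; apply: rtensor_ext => [||s1 t1]; try exact: rmul1D.
by rewrite !rmul1_tens -!mulrA rtensZ.
Qed.
Lemma rmul_tensl s t : rmul (rtens s t) w = rmul1 s t w.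
Proof. exact: rtlift_tens. Qed.
Lemma rmulDl : {morph rmul^~ w : z z' / z + z'}.
Proof. exact: rtliftD. Qed.
End rmul_w.

Lemma rmul_tens s t s' t' : rmul (rtens s t) (rtens s' t') = rtens (s * s') (t * t').
Proof. by rewrite rmul_tensl rmul1_tens. Qed.

Lemma rmulDr z : {morph rmul z : w w' / w + w'}.
Proof.
move=> w w'; move: z; apply: rtensor_ext => [||s t]; first exact: rmulDl.
  by move=> z z'; rewrite !rmulDl addrACA.
by rewrite !rmul_tensl rmul1D.
Qed.

Fact rmulA : associative rmul.
Proof.
move=> z w y; move: z; apply: rtensor_ext => [||s t]; first exact: rmulDl.
  by move=> z z'; rewrite !rmulDl.
move: w; apply: rtensor_ext => [||s' t'].
- by move=> z z'; rewrite rmulDl rmulDr.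
- by move=> z z'; rewrite rmulDr rmulDl.
move: y; apply: rtensor_ext => [||s'' t''].
- by move=> z z'; rewrite !rmulDr.
- by move=> z z'; rewrite !rmulDr.
by rewrite !rmul_tens !mulrA.
Qed.

Fact rmulC : commutative rmul.
Proof.
move=> z w; move: z; apply: rtensor_ext => [||s t]; first exact: rmulDl.
  exact: rmulDr.
move: w; apply: rtensor_ext => [||s' t']; first exact: rmulDr.
  exact: rmulDl.
by rewrite !rmul_tens mulrC [t * t']mulrC.
Qed.

Fact rmul1r : left_id (rtens 1 1) rmul.
Proof.
apply: rtensor_ext => [||s t] //; first exact: rmulDr.
by rewrite rmul_tens !mul1r.
Qed.

Fact rmul_distl : left_distributive rmul +%R.
Proof. by move=> z z' w; rewrite rmulDl. Qed.

HB.instance Definition _ :=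
  GRing.Zmodule_isComPzRing.Build rtensor rmulA rmulC rmul1r rmul_distl.

Lemma rtensM s t s' t' : rtens s t * rtens s' t' = rtens (s * s') (t * t').
Proof. exact: rmul_tens. Qed.

Definition rinr (t : T) : rtensor := rtens 1 t.
Definition rinl (s : S) : rtensor := rtens s 1.

Fact rinr_zmod : zmod_morphism rinr.
Proof. by move=> t t'; rewrite /rinr; apply/eqP; rewrite eq_sym subr_eq -rtensDr subrK. Qed.
Fact rinr_monoid : monoid_morphism rinr.
Proof. by split=> // t t'; rewrite /rinr rtensM mulr1. Qed.
HB.instance Definition _ := GRing.isZmodMorphism.Build T rtensor rinr rinr_zmod.
HB.instance Definition _ := GRing.isMonoidMorphism.Build T rtensor rinr rinr_monoid.
Fact rinl_zmod : zmod_morphism rinl.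
Proof. by move=> t t'; rewrite /rinl; apply/eqP; rewrite eq_sym subr_eq -rtensDl subrK. Qed.
Fact rinl_monoid : monoid_morphism rinl.
Proof. by split=> // t t'; rewrite /rinl rtensM mulr1. Qed.
HB.instance Definition _ := GRing.isZmodMorphism.Build S rtensor rinl rinl_zmod.
HB.instance Definition _ := GRing.isMonoidMorphism.Build S rtensor rinl rinl_monoid.

Lemma rtensE s t : rtens s t = rinl s * rinr t.
Proof. by rewrite rtensM mulr1 mul1r. Qed.

Lemma rtensor_is_ring_tensor : is_ring_tensor f g rinr rinl.
Proof.
split=> [r|C i j ij].
  by have := rtensZ r 1 1; rewrite !mulr1.
pose beta s t := j s * i t.
have bl s s' t : beta (s + s') t = beta s t + beta s' t by rewrite /beta rmorphD mulrDl.
have br s t t' : beta s (t + t') = beta s t + beta s t' by rewrite /beta rmorphD mulrDr.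
have bA a s t : beta (g a * s) t = beta s (f a * t).
  by rewrite /beta !rmorphM ij mulrAC mulrC.
pose k := rtlift beta.
have kD : {morph k : z w / z + w} := rtliftD bl br bA.
have kt s t : k (rtens s t) = j s * i t := rtlift_tens bl br bA s t.
have adjoin1_invertible : zmod_morphism k.
  by move=> z z'; apply/eqP; rewrite eq_sym subr_eq -kD subrK.
have km : monoid_morphism k.
  split=> [|z w]; first by rewrite kt !rmorph1 mulr1.
  move: z; apply: rtensor_ext => [z z'|z z'|s t].
  - by rewrite mulrDl kD.
  - by rewrite kD mulrDl.
  move: w; apply: rtensor_ext => [z z'|z z'|s' t'].
  - by rewrite mulrDr kD.
  - by rewrite kD mulrDr.
  by rewrite rtensM !kt !rmorphM mulrACA.
pose m1 := GRing.isZmodMorphism.Build _ _ k adjoin1_invertible.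
pose m2 := GRing.isMonoidMorphism.Build _ _ k km.
pose K : {rmorphism rtensor -> C} := HB.pack k m1 m2.
split.
  exists K; split=> [t|s]; rewrite /K /=.
    by rewrite kt rmorph1 mul1r.
  by rewrite kt rmorph1 mulr1.
move=> h1 h2 h1i h1j h2i h2j; apply: rtensor_ext => [||s t]; try exact: raddfD.
by rewrite rtensE !rmorphM h1i h1j h2i h2j.
Qed.

End RingTensor.

(** * Linear relations and flatness *)

Section Ideal.
Variables (A : comPzRingType) (I : finType) (r : I -> A).
Definition ideal_pred : {pred A^o} :=
  fun a => `[< exists c : I -> A, a = \sum_i c i * r i >].
Fact ideal_submod : submod_closed ideal_pred.
Proof.
split=> [|a x y /asboolP[c ->] /asboolP[d ->]]; apply/asboolP.
  by exists (fun=> 0); rewrite big1 // => i _; rewrite mul0r.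
exists (fun i => a * c i + d i); rewrite scaler_sumr -big_split.
by apply: eq_bigr => i _; rewrite mulrDl -mulrA.
Qed.
HB.instance Definition _ := GRing.isSubmodClosed.Build A A^o ideal_pred ideal_submod.
(** The ideal as a module of its own: flatness will be tested on its inclusion into [A^o]. *)
Record ideal_of := MkIdeal { ideal_val : A^o; _ : ideal_val \in ideal_pred }.
HB.instance Definition _ := [isSub for ideal_val].
HB.instance Definition _ := [Choice of ideal_of by <:].
HB.instance Definition _ := [SubChoice_isSubLmodule of ideal_of by <:].
End Ideal.

Section Flatness.
Variables (A B : comPzRingType) (phi : {rmorphism A -> B}).

(** The predicate [G] stays arbitrary because it stands in turn for one scalar equation, a system of
    them, and equations with values in a module. *)
Definition gen_span (X : Type) (G : (X -> A) -> Prop) (t : X -> B) : Prop :=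
  exists (J : finType) (rho : J -> X -> A) (tau : J -> B),
    (forall j, G (rho j)) /\ (forall x, t x = \sum_j phi (rho j x) * tau j).

(** The equational criterion of flatness, for a single relation. *)
Definition eqflat : Prop := forall (I : finType) (r : I -> A) (u : I -> B),
  \sum_i phi (r i) * u i = 0 -> gen_span (fun rho => \sum_i r i * rho i = 0) u.

Lemma gen_span0 (X : Type) (G : (X -> A) -> Prop) (t : X -> B) :
  (forall x, t x = 0) -> gen_span G t.
Proof.
move=> t0; exists void, (fun=> fun=> 0), (fun=> 0); split=> [[]|x].
by rewrite t0 big1 // => -[].
Qed.

Lemma gen_spanD (X : Type) (G : (X -> A) -> Prop) (t1 t2 t : X -> B) :
  gen_span G t1 -> gen_span G t2 -> (forall x, t x = t1 x + t2 x) -> gen_span G t.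
Proof.
move=> [J1 [r1 [v1 [z1 e1]]]] [J2 [r2 [v2 [z2 e2]]]] e.
exists (J1 + J2)%type, (fun j => match j with inl j => r1 j | inr j => r2 j end),
  (fun j => match j with inl j => v1 j | inr j => v2 j end).
by split=> [[]//|x]; rewrite e e1 e2 big_sumType.
Qed.

Lemma gen_span1 (X : Type) (G : (X -> A) -> Prop) (rho : X -> A) (b : B) (t : X -> B) :
  G rho -> (forall x, t x = phi (rho x) * b) -> gen_span G t.
Proof.
move=> Gr e; exists unit, (fun=> rho), (fun=> b); split=> // x.
by rewrite e (bigD1 tt) //= big1 ?addr0 // => -[].
Qed.

Lemma gen_span_sum (X : Type) (J : finType) (G : (X -> A) -> Prop)
    (T : J -> X -> B) (t : X -> B) :
  (forall j, gen_span G (T j)) -> (forall x, t x = \sum_j T j x) -> gen_span G t.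
Proof.
move=> GT e.
have {GT} : forall s : seq J, gen_span G (fun x => \sum_(j <- s) T j x).
  elim=> [|j s IH]; first by apply: gen_span0 => x; rewrite big_nil.
  by apply: (gen_spanD (GT j) IH) => x; rewrite big_cons.
move=> /(_ (index_enum J))/gen_spanD/(_ (gen_span0 G (t := fun=> 0) _)); apply=> // x.
by rewrite e addr0.
Qed.

(** Induction on the equations: solutions of the earlier ones are substituted into the next, which
    becomes a single relation between the coefficients [tau]. *)
Lemma eqflat_system : eqflat ->
  forall (I K : finType) (r : K -> I -> A) (u : I -> B),
  (forall k, \sum_i phi (r k i) * u i = 0) ->
  gen_span (fun rho => forall k, \sum_i r k i * rho i = 0) u.
Proof.
move=> fl I K r u r0.
suff: gen_span (fun rho => forall k, k \in enum K -> \sum_i r k i * rho i = 0) u.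
  move=> [J [rho [tau [z e]]]]; exists J, rho, tau; split=> // j k.
  by apply: z; rewrite mem_enum.
elim: (enum K) => [|k s [J [rho [tau [z e]]]]].
  (* Without equations, the unit vectors generate everything. *)
  exists I, (fun j i => (i == j)%:R), u; split=> // i.
  rewrite (bigD1 i) //= eqxx rmorph1 mul1r big1 ?addr0 // => j /negPf.
  by rewrite eq_sym => ->; rewrite rmorph0 mul0r.
have /fl[J' [sig [om [z' e']]]] : \sum_j phi (\sum_i r k i * rho j i) * tau j = 0.
  rewrite -[RHS](r0 k).
  under [RHS]eq_bigr => i _ do rewrite e mulr_sumr.
  rewrite exchange_big; apply: eq_bigr => j _ /=.
  rewrite rmorph_sum mulr_suml; apply: eq_bigr => i _.
  by rewrite rmorphM mulrA.
exists J', (fun q i => \sum_j rho j i * sig q j), om; split=> [q l|i].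
  have E : \sum_i r l i * (\sum_j rho j i * sig q j) =
      \sum_j (\sum_i r l i * rho j i) * sig q j.
    under eq_bigr => i _ do rewrite mulr_sumr.
    rewrite exchange_big; apply: eq_bigr => j _ /=.
    by rewrite mulr_suml; apply: eq_bigr => i _; rewrite mulrA.
  rewrite inE E => /orP[/eqP->|ls]; first exact: z'.
  by rewrite big1 // => j _; rewrite z // mul0r.
rewrite e; under eq_bigr => j _ do rewrite e' mulr_sumr.
rewrite exchange_big; apply: eq_bigr => q _ /=.
by rewrite rmorph_sum mulr_suml; apply: eq_bigr => j _; rewrite rmorphM mulrA.
Qed.

Lemma fcoef_fin (N : lmodType A) (M : zmodType) (I : finType) (n : I -> N)
    (u : I -> M) x :
  fcoef [seq (n i, u i) | i <- enum I] x = \sum_(i | n i == x) u i.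
Proof. by rewrite /fcoef big_map big_enum_cond. Qed.

(** By [tens_sum_eq0] the vanishing amounts to a finite linear system over [A], with one equation
    for each element of [D] and with unknowns the [u i] and the multipliers [v j]. A scalar solution
    of the system gives a combination of the [n i] equal to one of the null relations [r j]. *)
Lemma eqflat_tensor (N : lmodType A) : eqflat ->
  forall (I : finType) (n : I -> N) (u : I -> B),
  \sum_i tens phi (n i) (u i) = 0 ->
  gen_span (fun rho => \sum_i rho i *: n i = 0) u.
Proof.
move=> fl I n u nu0.
have [J [v [r [r0 e]]]] : tnull phi (fcoef [seq (n i, u i) | i <- enum I]).
  by apply: tens_sum_eq0; rewrite big_map big_enum.
pose D := undup (map n (enum I) ++ flatten [seq map fst (r j) | j <- enum J]).
have uD : uniq D by exact: undup_uniq.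
have nD a : {subset map fst [seq (n i, a i : A) | i <- enum I] <= D}.
  by move=> x; rewrite -map_comp mem_undup mem_cat => ->.
have rD j : {subset map fst (r j) <= D}.
  move=> x xs; rewrite mem_undup mem_cat; apply/orP; right.
  by apply/flatten_mapP; exists j; rewrite ?mem_enum.
pose E (k : seq_sub D) (l : I + J) : A :=
  match l with inl i => (n i == val k)%:R | inr j => - fcoef (r j) (val k) end.
pose w l := match l with inl i => u i | inr j => v j end.
have /(eqflat_system fl) : forall k, \sum_l phi (E k l) * w l = 0.
  move=> k; rewrite big_sumType /=.
  have -> : \sum_i phi (n i == val k)%:R * u i = fcoef [seq (n i, u i) | i <- enum I] (val k).
    rewrite fcoef_fin [RHS]big_mkcond; apply: eq_bigr => i _.
    by case: eqP; rewrite ?(rmorph1, rmorph0, mul1r, mul0r).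
  by rewrite e -big_split big1 // => j _ /=; rewrite rmorphN mulNr subrr.
move=> [Q [rho [tau [z e']]]].
exists Q, (fun q i => rho q (inl i)), tau; split=> [q|i]; last exact: (e' (inl i)).
have scD (x : N) : {morph (fun a : A => a *: x) : a b / a + b}.
  by move=> a b; rewrite scalerDl.
have -> : \sum_i rho q (inl i) *: n i =
    \sum_(p <- [seq (n i, rho q (inl i)) | i <- enum I]) p.2 *: p.1.
  by rewrite big_map big_enum.
rewrite (fcoef_sum (b := fun x a => a *: x) scD uD (@nD _)).
have -> : \sum_(x <- D) fcoef [seq (n i, rho q (inl i)) | i <- enum I] x *: x =
    \sum_(x <- D) \sum_j rho q (inr j) *: (fcoef (r j) x *: x).
  apply: eq_big_seq => x xD; have := z q (SeqSub xD).
  rewrite big_sumType /= fcoef_fin.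
  have -> : \sum_i (n i == x)%:R * rho q (inl i) = \sum_(i | n i == x) rho q (inl i).
    by rewrite [RHS]big_mkcond; apply: eq_bigr => i _; case: eqP; rewrite ?(mul1r, mul0r).
  move/eqP; rewrite addr_eq0 => /eqP->.
  rewrite -sumrN scaler_suml; apply: eq_bigr => j _.
  by rewrite mulNr opprK scalerA mulrC.
rewrite exchange_big big1 // => j _ /=.
by rewrite -scaler_sumr -(fcoef_sum (b := fun x a => a *: x) scD uD (rD j)) r0 scaler0.
Qed.

(** Flatness is applied to the inclusion into [A] of the ideal generated by [r]: the tensor of the
    [n i] and [u i] already vanishes over the ideal, and its null relations are rewritten with
    chosen coefficients [c] with respect to [r]. *)
Lemma flat_eqflat : flat_morphism phi -> eqflat.
Proof.
move=> fl I r u ru0.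
pose N := ideal_of r.
have rP i : r i \in ideal_pred r.
  apply/asboolP; exists (fun j => (j == i)%:R).
  by rewrite (bigD1 i) //= eqxx mul1r big1 ?addr0 // => j /negPf->; rewrite mul0r.
pose n i : N := MkIdeal (rP i).
pose b (x : N) (y : B) := tens phi (val x) y.
have bb : balanced phi b.
  split=> *; rewrite /b ?(tensDr, raddfD, tensDl, scale_tens) //.
  by rewrite linearZ tensZ.
have [G Gt] := balanced_lift bb.
have Ginj : injective G.
  apply: (fl N A^o (val : {linear N -> A^o}) val_inj _ _ _ _
    (tens_is_tensor phi N) (tens_is_tensor phi A^o) G) => x y.
  exact: Gt.
have nu0 : \sum_i tens phi (n i) (u i) = 0.
  apply: Ginj; rewrite raddf0 raddf_sum /=.
  under eq_bigr => i _ do rewrite Gt /b /=.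
  have -> : \sum_i tens phi (r i : A^o) (u i) = tens phi (1 : A^o) (\sum_i phi (r i) * u i).
    rewrite (big_morph _ (@tensDr _ _ phi _ _) (id1 := 0)); last first.
      by apply: (addrI (tens phi (1 : A^o) 0)); rewrite -tensDr !addr0.
    by apply: eq_bigr => i _; rewrite -tensZ /GRing.scale /= mulr1.
  by rewrite ru0; apply: (addrI (tens phi (1 : A^o) 0)); rewrite -tensDr !addr0.
have [J [v [ro [r0 e]]]] : tnull phi (fcoef [seq (n i, u i) | i <- enum I]).
  by apply: tens_sum_eq0; rewrite big_map big_enum.
have /choice[c cE] : forall x : N, exists c : I -> A, ideal_val x = \sum_i c i * r i.
  by move=> [x xP]; apply/asboolP.
pose D := undup (map n (enum I) ++ flatten [seq map fst (ro j) | j <- enum J]).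
have uD : uniq D by exact: undup_uniq.
have nD : {subset map fst [seq (n i, u i) | i <- enum I] <= D}.
  by move=> x; rewrite -map_comp mem_undup mem_cat => ->.
have rD j : {subset map fst (ro j) <= D}.
  move=> x xs; rewrite mem_undup mem_cat; apply/orP; right.
  by apply/flatten_mapP; exists j; rewrite ?mem_enum.
(* The family [u] splits into two parts. In [t1], the unit vector at [k] minus [c (n k)] is a
   relation, as both represent [r k]; [t2] is the remaining sum of the [c (n k) i] times [u k],
   rewritten through the null relations [ro j]. *)
pose t1 k i : B := phi ((i == k)%:R - c (n k) i) * u k.
pose t2 j i : B := phi (\sum_(p <- ro j) p.2 * c p.1 i) * v j.
apply: (gen_spanD (t1 := fun i => \sum_k t1 k i) (t2 := fun i => \sum_j t2 j i)).
- apply: (gen_span_sum (T := t1)) => // k.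
  apply: (gen_span1 (rho := fun i => (i == k)%:R - c (n k) i) (b := u k)) => //.
  under eq_bigr => i _ do rewrite mulrBr.
  rewrite sumrB (bigD1 k) //= eqxx mulr1 big1 ?addr0; last first.
    by move=> i /negPf->; rewrite mulr0.
  apply/eqP; rewrite subr_eq0; apply/eqP; rewrite [LHS](cE (n k)).
  by apply: eq_bigr => i _; rewrite mulrC.
- apply: (gen_span_sum (T := t2)) => // j.
  apply: (gen_span1 (rho := fun i => \sum_(p <- ro j) p.2 * c p.1 i) (b := v j)) => //.
  have E : \sum_(p <- ro j) p.2 * (ideal_val p.1 : A) = 0.
    by have := congr1 (val : N -> A^o) (r0 j); rewrite raddf_sum raddf0.
  apply: etrans E; under eq_bigr => i _ do rewrite mulr_sumr.
  rewrite exchange_big /=; apply: eq_bigr => p _; rewrite cE mulr_sumr.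
  by apply: eq_bigr => i _; rewrite mulrCA [r i * _]mulrC.
- move=> i; under eq_bigr => k _ do rewrite /t1 rmorphB mulrBl.
  rewrite sumrB (bigD1 i) //= eqxx rmorph1 mul1r big1 ?addr0; last first.
    by move=> k /negPf; rewrite eq_sym => ->; rewrite rmorph0 mul0r.
  suff -> : \sum_j t2 j i = \sum_k phi (c (n k) i) * u k by rewrite subrK.
  have -> : \sum_k phi (c (n k) i) * u k =
      \sum_(p <- [seq (n k, u k) | k <- enum I]) phi (c p.1 i) * p.2.
    by rewrite big_map big_enum.
  rewrite (fcoef_sum (b := fun x y => phi (c x i) * y) _ uD nD); last first.
    by move=> x y y'; rewrite mulrDr.
  under [RHS]eq_bigr => x _ do rewrite e mulr_sumr.
  rewrite exchange_big; apply: eq_bigr => j _ /=; rewrite /t2.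
  rewrite (fcoef_sum (b := fun x a => a * c x i) _ uD (rD j)); last first.
    by move=> x y y'; rewrite mulrDl.
  rewrite rmorph_sum mulr_suml; apply: eq_bigr => x _.
  by rewrite rmorphM mulrA [phi (c x i) * _]mulrC.
Qed.

(** Connects an arbitrary tensor product with the model. Pure tensors generate it because the
    composite through the model agrees with the identity on them, hence everywhere by uniqueness. *)
Lemma is_tensor_to_tensor (N P : lmodType A) (b : N -> B -> P) : is_tensor phi b ->
  exists (h : {linear P -> tensor phi N}),
    (forall n x, h (b n x) = tens phi n x) /\
    (forall z, exists s, z = \sum_(p <- s) b p.1 p.2).
Proof.
move=> [bb univ].
have [[h hE] _] := univ _ _ (tens_balanced phi N).
have [k kE] := balanced_lift bb.
exists h; split=> // z.
have -> : z = k (h z).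
  have [_ /(_ (idfun : {linear P -> P}) (k \o h : {linear P -> P}))] := univ _ _ bb.
  by apply=> // n x /=; rewrite hE kE.
have [s ->] := tensorP (h z); exists s; rewrite raddf_sum.
by apply: eq_bigr => p _; rewrite -kE.
Qed.

(** An element of the kernel is trivialized by relations that hold in [N']; as [f] is injective they
    hold in [N], so the element is 0. *)
Lemma eqflat_flat : eqflat -> flat_morphism phi.
Proof.
move=> fl N N' f finj P P' b b' tb tb' g gE.
have [h [_ bP]] := is_tensor_to_tensor tb.
have [h' [h'E _]] := is_tensor_to_tensor tb'.
have [[bl br ba bx] _] := tb.
suff g0 z : g z = 0 -> z = 0.
  move=> z w E; apply/eqP; rewrite -subr_eq0; apply/eqP/g0.
  by rewrite raddfB /= E subrr.
have [s ->] := bP z => /(congr1 h'); rewrite raddf0 !raddf_sum /=.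
under eq_bigr => p _ do rewrite gE h'E.
rewrite big_tnth => /(eqflat_tensor fl)[J [rho [tau [r0 e]]]].
have b0r n : b n 0 = 0 by apply: (addrI (b n 0)); rewrite -br !addr0.
have b0l x : b 0 x = 0 by apply: (addrI (b 0 x)); rewrite -bl !addr0.
rewrite big_tnth; under eq_bigr => i _ do rewrite e (big_morph _ (br _) (b0r _)).
rewrite exchange_big big1 // => j _ /=.
under eq_bigr => i _ do rewrite bx -ba.
rewrite -(big_morph (b^~ (tau j)) (fun n n' => bl n n' (tau j)) (b0l (tau j))).
suff -> : \sum_i rho j i *: (tnth (in_tuple s) i).1 = 0 by [].
apply: finj; rewrite raddf_sum raddf0 -[RHS](r0 j).
by apply: eq_bigr => i _; exact: linearZZ.
Qed.

End Flatness.

(** * Prüfer extensions *)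

(** Membership is a [Prop], since the subrings below are given inductively or by existence
    statements; [subring_of] turns them into rings to which [prufer] applies. *)
Record subring (S : comPzRingType) := Subring {
  subring_mem :> S -> Prop;
  subring_mem1 : subring_mem 1;
  subring_memB : forall x y, subring_mem x -> subring_mem y -> subring_mem (x - y);
  subring_memM : forall x y, subring_mem x -> subring_mem y -> subring_mem (x * y) }.

Section Subring.
Variables (S : comPzRingType) (V : subring S).
Definition subring_pred : {pred S} := fun x => `[< V x >].
Fact subring_pred_closed : subring_closed subring_pred.
Proof.
split=> [|x y /asboolP Vx /asboolP Vy|x y /asboolP Vx /asboolP Vy]; apply/asboolP.
- exact: subring_mem1.
- exact: subring_memB.
- exact: subring_memM.
Qed.
Record subring_of := MkSubring { subring_val : S; _ : subring_val \in subring_pred }.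
HB.instance Definition _ := [isSub for subring_val].
HB.instance Definition _ := [Choice of subring_of by <:].
HB.instance Definition _ := GRing.SubChoice_isSubComPzRing.Build S subring_pred subring_of subring_pred_closed.

Lemma subring_valP (x : subring_of) : V (val x).
Proof. by case: x => x xP; apply/asboolP. Qed.

Lemma subring_valK x : V x -> exists y : subring_of, val y = x.
Proof. by move/asboolP=> xP; exists (MkSubring xP). Qed.
End Subring.

Lemma corestriction (X U S : comPzRingType) (u : {rmorphism U -> S})
    (h : {rmorphism X -> S}) : injective u -> (forall x, exists y, u y = h x) ->
  exists k : {rmorphism X -> U}, forall x, u (k x) = h x.
Proof.
move=> uinj /choice[k kE].
have adjoin1_invertible : zmod_morphism k by move=> x y; apply: uinj; rewrite rmorphB !kE rmorphB.
have km : monoid_morphism k.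
  by split=> [|x y]; apply: uinj; rewrite ?rmorphM !kE ?rmorphM ?rmorph1.
pose m1 := GRing.isZmodMorphism.Build _ _ k adjoin1_invertible.
pose m2 := GRing.isMonoidMorphism.Build _ _ k km.
by exists (HB.pack k m1 m2 : {rmorphism X -> U}).
Qed.

(** The denominators of each [u] generate the unit ideal of [U]. *)
Definition weakly_surjective (A U : comPzRingType) (a : {rmorphism A -> U}) : Prop :=
  forall u, exists (J : finType) (d c : J -> A) (w : J -> U),
    (forall j, a (d j) * u = a (c j)) /\ \sum_j a (d j) * w j = 1.

(** For an epimorphism the two copies of [u] in the tensor square of [U] agree. Flatness trivializes
    this two-term relation between [u] and 1, and the coefficients of [u] are the denominators. *)
Lemma flat_epi_weakly_surjective (A U : comPzRingType) (a : {rmorphism A -> U}) :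
  flat_epimorphism a -> weakly_surjective a.
Proof.
move=> [/flat_eqflat fl epi] u.
have E : rinl a a u = rinr a a u.
  apply: (epi (rtensor a a) (rinl a a) (rinr a a)) => x.
  by have := rtensZ a a x 1 1; rewrite !mulr1.
pose n b : restr a := if b then u else 1.
pose v b : U := if b then 1 else - u.
have /(eqflat_tensor fl)[J [rho [tau [r0 e]]]] : \sum_b tens a (n b) (v b) = 0.
  rewrite big_bool /= /n /v.
  have -> : tens a (1 : restr a) (- u) = - rinr a a u by rewrite -rmorphN.
  by rewrite -[tens a _ _]/(rinl a a u) E subrr.
exists J, (rho ^~ true), (fun j => - rho j false), tau; split=> [j|].
  have := r0 j; rewrite big_bool /= /n !restr_scaleE mulr1 => /eqP.
  by rewrite addr_eq0 rmorphN => /eqP.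
by rewrite -(e true).
Qed.

Lemma weakly_surjective_epi (A U : comPzRingType) (a : {rmorphism A -> U}) :
  weakly_surjective a -> ring_epimorphism a.
Proof.
move=> ws C g h gh u; have [J [d [c [w [dc dw]]]]] := ws u.
rewrite -[g u]mulr1 -(rmorph1 h) -dw rmorph_sum mulr_sumr.
rewrite -[u in RHS]mul1r -dw mulr_suml rmorph_sum; apply: eq_bigr => j _.
by rewrite rmorphM mulrA -gh -rmorphM mulrC [u * _]mulrC dc gh -rmorphM mulrAC dc mulrC.
Qed.

(** * Rings generated by one element *)

Section Adjoin.
Variables (A S : comPzRingType) (g : {rmorphism A -> S}) (x : S).

(** The ring [A[x]] in Horner form, which makes inductions multiply by [x] one step at a time. *)
Inductive adjoin : S -> Prop :=
| adjoin_base a : adjoin (g a)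
| adjoin_step a s : adjoin s -> adjoin (g a + x * s).

Lemma adjoinX s : adjoin s -> adjoin (x * s).
Proof. by move/(adjoin_step 0); rewrite rmorph0 add0r. Qed.

Lemma adjoinD s t : adjoin s -> adjoin t -> adjoin (s + t).
Proof.
move=> sP; elim: sP t => [a|a s' s'P IH] t [b|b t' t'P].
- by rewrite -rmorphD; apply: adjoin_base.
- by rewrite addrA -rmorphD; apply: adjoin_step.
- by rewrite addrAC -rmorphD; apply: adjoin_step.
- by rewrite addrACA -rmorphD -mulrDr; apply: adjoin_step; apply: IH.
Qed.

Lemma adjoinZ b s : adjoin s -> adjoin (g b * s).
Proof.
elim=> [a|a s' _ IH]; first by rewrite -rmorphM; apply: adjoin_base.
by rewrite mulrDr -rmorphM mulrCA; apply: adjoin_step.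
Qed.

Lemma adjoinM s t : adjoin s -> adjoin t -> adjoin (s * t).
Proof.
move=> sP tP; elim: sP => [a|a s' _ IH]; first exact: adjoinZ.
by rewrite mulrDl -mulrA; apply: adjoinD; [exact: adjoinZ | exact: adjoinX].
Qed.

Lemma adjoin1 : adjoin 1.
Proof. by rewrite -(rmorph1 g); apply: adjoin_base. Qed.

Lemma adjoinB s t : adjoin s -> adjoin t -> adjoin (s - t).
Proof.
move=> sP tP; apply: adjoinD => //.
by rewrite -mulN1r -(rmorph1 g) -rmorphN; apply: adjoinZ.
Qed.

Definition adjoin_subring := Subring adjoin1 adjoinB adjoinM.

Lemma adjoin_id : adjoin x.
Proof. by rewrite -[x]mulr1; apply/adjoinX/adjoin1. Qed.

Lemma adjoin_poly s : adjoin s ->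
  exists n (c : nat -> A), s = \sum_(k < n) g (c k) * x ^+ k.
Proof.
elim=> [a|a _ _ [n [c ->]]].
  by exists 1%N, (fun=> a); rewrite big_ord1 mulr1.
exists n.+1, (fun k => if k is k'.+1 then c k' else a).
rewrite big_ord_recl mulr1 mulr_sumr; congr (_ + _).
by apply: eq_bigr => k _; rewrite exprS mulrCA.
Qed.
End Adjoin.

Lemma adjoin_sqr (A S : comPzRingType) (g : {rmorphism A -> S}) (x s : S) :
  adjoin g x s -> exists v w, [/\ adjoin g (x * x) v, adjoin g (x * x) w & s = v + w * x].
Proof.
elim=> [a|a _ _ [v [w [vP wP ->]]]].
  exists (g a), (g 0); split; [exact: adjoin_base | exact: adjoin_base |].
  by rewrite rmorph0 mul0r addr0.
exists (g a + x * x * w), v; split=> //; first exact: adjoin_step.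
by rewrite mulrDr [x * v]mulrC addrA addrAC [w * x]mulrC mulrA.
Qed.

Definition poly_span (S : comPzRingType) (V : S -> Prop) (x : S) n (w : S) : Prop :=
  exists v : 'I_n -> S, (forall k, V (v k)) /\ w = \sum_k v k * x ^+ k.

(* If [c_k] consists of the [e] with [e x^l] in [V] for all [l <= k], then the
   sums of products of elements of [c_k] and [W] include 1, for every [k];
   [x \in V] follows by taking [k = n]. *)
Lemma conductor_mem (S : comPzRingType) (V W : S -> Prop) (x : S) n (J : finType)
    (d w : J -> S) :
  V 0 -> V 1 -> (forall y z, V y -> V z -> V (y + z)) ->
  (forall y z, V y -> V z -> V (y * z)) ->
  W 1 -> W x -> (forall y z, W y -> W z -> W (y * z)) ->
  (forall y, W y -> poly_span V x n y) ->
  (forall j, V (d j)) -> (forall j, V (d j * x)) -> (forall j, W (w j)) ->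
  \sum_j d j * w j = 1 -> V x.
Proof.
move=> V0 V1 VD VM W1 Wx WM Wn dV dxV wW dw1.
have claim k : exists (I : finType) (e h : I -> S),
    [/\ forall i l, (l <= k)%N -> V (e i * x ^+ l), forall i, W (h i) &
        \sum_i e i * h i = 1].
  elim: k => [|k [I [e [h [eV hW eh1]]]]].
    exists unit, (fun=> 1), (fun=> 1); split=> [_ l|//|].
      by rewrite leqn0 => /eqP->; rewrite mulr1.
    by rewrite (bigD1 tt) //= big1 ?addr0 ?mulr1 // => -[].
  exists (I * J)%type, (fun p => e p.1 * d p.2), (fun p => h p.1 * w p.2); split.
  - move=> [i j] l; rewrite leq_eqVlt => /orP[/eqP->|lk] /=.
      by rewrite exprSr mulrACA; apply: VM => //; apply: eV.
    by rewrite mulrAC; apply: VM => //; apply: eV.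
  - by move=> [i j]; apply: WM.
  - rewrite -(pair_big xpredT xpredT (fun i j => e i * d j * (h i * w j))) /=.
    rewrite -[RHS]eh1; apply: eq_bigr => i _.
    by rewrite -[RHS]mulr1 -dw1 mulr_sumr; apply: eq_bigr => j _; rewrite mulrACA.
have [I [e [h [eV hW eh1]]]] := claim n.
rewrite -[x]mul1r -eh1 mulr_suml; apply: (big_ind V) => // i _.
have /Wn[v [vV E]] : W (h i * x) by exact: WM.
rewrite -mulrA E mulr_sumr; apply: (big_ind V) => // k _.
by rewrite mulrCA; apply: VM => //; apply: eV; apply: ltnW.
Qed.

Definition im (A S : comPzRingType) (g : {rmorphism A -> S}) (y : S) : Prop :=
  exists b, g b = y.

Section Image.
Variables (A S : comPzRingType) (g : {rmorphism A -> S}).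
Lemma im_id a : im g (g a). Proof. by exists a. Qed.
Lemma im0 : im g 0. Proof. by exists 0; rewrite rmorph0. Qed.
Lemma im1 : im g 1. Proof. by exists 1; rewrite rmorph1. Qed.
Lemma imD y z : im g y -> im g z -> im g (y + z).
Proof. by move=> [a <-] [b <-]; rewrite -rmorphD; apply: im_id. Qed.
Lemma imM y z : im g y -> im g z -> im g (y * z).
Proof. by move=> [a <-] [b <-]; rewrite -rmorphM; apply: im_id. Qed.
Lemma im_sum (I : finType) (F : I -> S) : (forall i, im g (F i)) -> im g (\sum_i F i).
Proof. by move=> H; apply: (big_ind (im g)) => //; [exact: im0 | exact: imD]. Qed.
End Image.
#[global] Hint Resolve im_id im0 im1 : core.

(** * Integral closedness and invertibility in Prüfer extensions *)

Section PruferExt.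
Variables (A S : comPzRingType) (g : {rmorphism A -> S}).
Hypothesis gP : prufer g.

(** Weak surjectivity of [A] in [A[x]], rather than in [S]: it matters for [conductor_mem] that the
    cofactors [w j] lie in [A[x]]. *)
Lemma prufer_adjoin x : exists (J : finType) (d c : J -> A) (w : J -> S),
  [/\ forall j, g (d j) * x = g (c j), forall j, adjoin g x (w j) &
      \sum_j g (d j) * w j = 1].
Proof.
pose U := subring_of (adjoin_subring g x).
pose u : {rmorphism U -> S} := val.
have uinj : injective u := val_inj.
have [a aE] : exists a : {rmorphism A -> U}, forall y, u (a y) = g y.
  apply: corestriction => // y.
  by have [z zE] := subring_valK (V := adjoin_subring g x) (adjoin_base g x y); exists z.
have /flat_epi_weakly_surjective ws : flat_epimorphism a by apply: gP.2 uinj aE.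
have [x' x'E] := subring_valK (V := adjoin_subring g x) (adjoin_id g x).
have [J [d [c [w [dc dw]]]]] := ws x'.
exists J, d, c, (fun j => u (w j)); split=> [j|j|].
- by have := congr1 u (dc j); rewrite rmorphM !aE /u /= x'E.
- exact: (subring_valP (w j)).
- have := congr1 u dw; rewrite rmorph1 rmorph_sum => <-.
  by apply: eq_bigr => j _; rewrite rmorphM aE.
Qed.

Lemma prufer_integrally_closed y : integral_over g y -> im g y.
Proof.
move=> [n [c yn]]; have [J [d [b [w [db wP dw]]]]] := prufer_adjoin y.
(* In degree 0 the equation reads [1 = 0] and [S] is zero. From here on [n] is one less than the
   degree. *)
case: n c yn => [|n] c yn.
  have E : forall z : S, z = 0.
    by move=> z; rewrite -[z]mul1r; move: yn; rewrite big_ord0 addr0 expr0 => ->; rewrite mul0r.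
  by rewrite (E y).
have mon a k : (k <= n)%N -> poly_span (im g) y n.+1 (g a * y ^+ k).
  move=> kn; exists (fun l => if l == k :> nat then g a else 0); split=> [l|].
    by case: ifP.
  rewrite (bigD1 (inord k)) //= inordK // eqxx big1 ?addr0 // => l lk.
  case: ifP => [/eqP E|_]; last by rewrite mul0r.
  by case/eqP: lk; apply: val_inj; rewrite /= inordK.
have spD s t : poly_span (im g) y n.+1 s -> poly_span (im g) y n.+1 t ->
    poly_span (im g) y n.+1 (s + t).
  move=> [v [vP ->]] [v' [v'P ->]]; exists (fun k => v k + v' k).
  split=> [k|]; first exact: imD.
  by rewrite -big_split; apply: eq_bigr => k _; rewrite mulrDl.
have sp0 : poly_span (im g) y n.+1 0.
  by exists (fun=> 0); split=> [//|]; rewrite big1 // => k _; rewrite mul0r.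
apply: (conductor_mem (V := im g) (W := adjoin g y) (n := n.+1) (d := fun j => g (d j)) (w := w))
  => //; try exact: imD; try exact: imM; try exact: adjoinM; try exact: adjoin1.
- exact: adjoin_id.
(* The span of the powers up to [n] is stable under multiplication by [y]: only the power [n.+1]
   leaves it, and the integral equation rewrites that one. *)
- move=> s; elim=> [a|a t _ [v [vP ->]]]; first by have := mon a 0%N (leq0n n); rewrite mulr1.
  apply: (spD); first by have := mon a 0%N (leq0n n); rewrite mulr1.
  rewrite mulr_sumr; apply: (big_ind (poly_span (im g) y n.+1) sp0 spD) => k _.
  have [e <-] := vP k; rewrite mulrCA -exprS.
  have [kn|kn] := ltnP k n; first exact: mon.
  have -> : k.+1 = n.+1 by apply/eqP; rewrite eqSS eqn_leq kn -ltnS ltn_ord.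
  move/eqP: yn; rewrite addr_eq0 => /eqP->; rewrite mulrN mulr_sumr -sumrN.
  apply: (big_ind (poly_span (im g) y n.+1) sp0 spD) => l _; rewrite mulrA -rmorphM -mulNr -rmorphN.
  by apply: mon; rewrite -ltnS.
- by move=> j; rewrite db.
Qed.

(** Here [conductor_mem] is applied to [A[x^2]] inside [A[x]], which is spanned by 1 and [x] over
    it. *)
Lemma prufer_mem_adjoin_sqr x : adjoin g (x * x) x.
Proof.
have [J [d [b [w [db wP dw]]]]] := prufer_adjoin x.
apply: (conductor_mem (V := adjoin g (x * x)) (W := adjoin g x) (n := 2)
  (d := fun j => g (d j)) (w := w)) => //;
  try exact: adjoinM; try exact: adjoin1; try exact: adjoinD; try exact: adjoin_id.
- by rewrite -(rmorph0 g); apply: adjoin_base.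
- move=> s /adjoin_sqr[v [v' [vP v'P ->]]].
  exists (fun k => if k == ord0 then v else v'); split=> [k|]; first by case: ifP.
  by rewrite big_ord_recl big_ord1 /= mulr1.
- by move=> j; apply: adjoin_base.
- by move=> j; rewrite db; apply: adjoin_base.
Qed.

(* The elements [a] and [b] lie in [(A : x)], the inverse of the module [A + A x]. *)
Definition adjoin1_invertible : Prop := forall x : S, exists a b : A,
  [/\ g a + g b * x = 1, im g (g a * x) & im g (g b * x)].

(** Multiplying the equation by [b ^+ n] makes it monic in [b x], which is therefore integral. *)
Lemma prufer_mul_root (p : nat -> A) b x n :
  g b * x ^+ n.+1 + \sum_(k < n.+1) g (p k) * x ^+ k = 0 -> im g (g b * x).
Proof.
move=> E; apply: prufer_integrally_closed.
exists n.+1, (fun k => p k * b ^+ (n - k)).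
have := congr1 (fun z => g b ^+ n * z) E; rewrite mulr0 => E'; apply: etrans E'.
rewrite mulrDr; congr (_ + _).
  by rewrite exprMn exprSr -mulrA.
rewrite mulr_sumr; apply: eq_bigr => k _; rewrite exprMn rmorphM rmorphXn.
have -> : g b ^+ n = g b ^+ (n - k) * g b ^+ k.
  by rewrite -exprD subnK // -ltnS ltn_ord.
by rewrite mulrACA mulrCA !mulrA [_ * g (p k)]mulrAC.
Qed.

(* As [x] lies in [A[x^2]], it is a root of a polynomial [p] with [p_1 = 1]; the
   partial values of its Horner scheme lie in [(A : x)] because [A] is
   integrally closed in [S], and two of them are the required [a] and [b]. *)
Lemma prufer_adjoin1_invertible : adjoin1_invertible.
Proof.
move=> x; have /adjoin_poly[m [c E]] := prufer_mem_adjoin_sqr x.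
have {m c E} [n [p [p1 E]]] : exists n (p : nat -> A), p 1%N = 1 /\
    \sum_(k < n.+2) g (p k) * x ^+ k = 0.
  pose c' k := if (k < m)%N then c k else 0.
  have {}E : x = \sum_(k < m.+1) g (c' k) * (x * x) ^+ k.
    rewrite big_ord_recr /= {2}/c' ltnn rmorph0 mul0r addr0 {1}E.
    by apply: eq_bigr => k _; rewrite /c' ltn_ord.
  (* The polynomial in [x^2] has only even exponents, so subtracting it from [X] leaves the
     coefficient 1 of [X] intact. *)
  pose q k : A := if odd k then 0 else c' k./2.
  have qE l : \sum_(k < l.*2) g (q k) * x ^+ k = \sum_(k < l) g (c' k) * (x * x) ^+ k.
    elim: l => [|l IH]; first by rewrite !big_ord0.
    rewrite doubleS !big_ord_recr /= IH /q /= odd_double /= doubleK rmorph0 mul0r addr0.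
    by rewrite -expr2 -exprM mul2n.
  exists m.*2, (fun k => (k == 1%N)%:R - q k); split; first by rewrite eqxx /q /= subr0.
  under eq_bigr => k _ do rewrite rmorphB mulrBl.
  rewrite sumrB -doubleS qE -E doubleS !big_ord_recl big1 /= => [|k _].
    by rewrite rmorph0 rmorph1 mul0r add0r mul1r expr1 addr0 subrr.
  by rewrite rmorph0 mul0r.
(* A leading term 0 is added so that the induction can carry an arbitrary leading coefficient [b].
   Each step absorbs [b x], an element of [A], into the next coefficient and lowers the degree; at
   the end [b x + 1] and [- b] are the witnesses. *)
have {E} : g 0 * x ^+ n.+2 + \sum_(k < n.+2) g (p k) * x ^+ k = 0.
  by rewrite rmorph0 mul0r add0r.
elim: n 0 => [|n IH] b E; have [b' b'E] := prufer_mul_root E.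
  have E1 : g (b' + p 1%N) * x ^+ 1 + \sum_(k < 1) g (p k) * x ^+ k = 0.
    rewrite -[RHS]E [in RHS]big_ord_recr /= rmorphD b'E mulrDl expr1 expr2 mulrA.
    by rewrite -addrA [g (p _) * x + _]addrC.
  exists (b' + p 1%N), (- b); split.
  - by rewrite rmorphN mulNr -b'E p1 rmorphD rmorph1 addrAC subrr add0r.
  - exact: prufer_mul_root E1.
  - by rewrite rmorphN mulNr -b'E -rmorphN.
apply: (IH (b' + p n.+2)); rewrite -[RHS]E [in RHS]big_ord_recr /= rmorphD b'E.
by rewrite mulrDl [x ^+ n.+3]exprS mulrA -addrA [g (p _) * _ + _]addrC.
Qed.
End PruferExt.

(** * Invertible modules *)

Section Invertibility.
Variables (A S : comPzRingType) (g : {rmorphism A -> S}).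
Hypothesis ginv : adjoin1_invertible g.

(** The module meant is the one spanned by [M]: the [e j] lie in its inverse [(A : M)], and the
    product with the inverse contains 1. *)
Definition invertible_span (M : S -> Prop) : Prop :=
  exists (J : finType) (e m : J -> S),
    [/\ forall j, M (m j), forall j x, M x -> im g (e j * x) & \sum_j e j * m j = 1].

(* Where [a] is a unit, [1 :: x :: Y] spans the same module as [1 :: Y]; where
   [b x] is a unit, the same module as [x * (1 :: b Y)]. *)
Lemma invertible_seq (Y : seq S) : invertible_span (fun x => x \in 1 :: Y).
Proof.
(* Induction on the size, because the hypothesis is also needed for the scaled list [b Y]. *)
move: {2}(size Y) (erefl (size Y)) => n; elim: n Y => [|n IH] [|x Y] // sY.
  exists unit, (fun=> 1), (fun=> 1); split=> [_|_ x|]; rewrite ?inE //.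
    by move/eqP->; rewrite mulr1.
  by rewrite (bigD1 tt) //= big1 ?addr0 ?mulr1 // => -[].
have [a [b [ab1 ax bx]]] := ginv x.
have {sY} sY : size Y = n by case: sY.
have [J1 [e1 [m1 [m1P e1P em1]]]] := IH Y sY.
have [J2 [e2 [m2 [m2P e2P em2]]]] : invertible_span (fun z => z \in 1 :: [seq g b * y | y <- Y]).
  by apply: IH; rewrite size_map.
(* Transport from [1 :: b Y] by the factor [b x]: the generator 1 is replaced by [x] and [b y] by
   [y], while [b * e2 j] sends all of [1, x, Y] into [A]. *)
have /choice[F FP] : forall j : J2, exists em : S * S,
    [/\ em.2 \in [:: 1, x & Y], forall z, z \in [:: 1, x & Y] -> im g (em.1 * z) &
        em.1 * em.2 = g b * x * (e2 j * m2 j)].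
  move=> j.
  have ib z : z \in [:: 1, x & Y] -> im g (g b * e2 j * z).
    have e2j : im g (e2 j) by rewrite -[e2 j]mulr1; apply: e2P; rewrite inE eqxx.
    rewrite !inE => /or3P[/eqP->|/eqP->|zY].
    - by rewrite mulr1; apply: imM.
    - by rewrite mulrAC; apply: imM.
    - rewrite mulrAC mulrC; apply: e2P; rewrite inE; apply/orP; right.
      exact: map_f.
  have := m2P j; rewrite inE => /orP[/eqP->|/mapP[y yY ->]].
    exists (g b * e2 j, x); split=> //=; first by rewrite !inE eqxx orbT.
    by rewrite mulr1 mulrAC.
  exists (g b * e2 j * (g b * x), y); split=> /=.
  - by rewrite !inE yY !orbT.
  - by move=> z zM; rewrite mulrAC; apply: imM => //; apply: ib.
  - by rewrite mulrAC mulrC; congr (_ * _); rewrite mulrAC mulrC.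
exists (J1 + J2)%type,
  (fun j => match j with inl j => g a * e1 j | inr j => (F j).1 end),
  (fun j => match j with inl j => m1 j | inr j => (F j).2 end); split.
- move=> [j|j]; last by have [] := FP j.
  by have := m1P j; rewrite !inE => /orP[->|->] //; rewrite !orbT.
- move=> [j|j] z; last by have [_ H _] := FP j; apply: H.
  rewrite !inE => /or3P[zY|/eqP->|zY].
  + by rewrite -mulrA; apply: imM => //; apply: e1P; rewrite inE zY.
  + rewrite mulrAC; apply: imM => //; rewrite -[e1 j]mulr1; apply: e1P.
    by rewrite inE eqxx.
  + by rewrite -mulrA; apply: imM => //; apply: e1P; rewrite inE zY orbT.
- rewrite big_sumType /= -[RHS]ab1; congr (_ + _).
    by rewrite -[RHS]mulr1 -em1 mulr_sumr; apply: eq_bigr => j _; rewrite mulrA.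
  rewrite -[RHS]mulr1 -em2 mulr_sumr; apply: eq_bigr => j _.
  by have [] := FP j.
Qed.

(** The span of the [a i] may miss 1, which [invertible_seq] requires. The products [a k * m l] are
    added as well, so that each term [e j * n j] can be rewritten as a combination of the [a i]
    whose coefficients still send every [a k] into [A]. *)
Lemma invertible_family (I : finType) (a m : I -> S) : \sum_i a i * m i = 1 ->
  exists c : I -> S, (forall i k, im g (c i * a k)) /\ \sum_i c i * a i = 1.
Proof.
move=> am1.
pose Y := [seq a i | i <- enum I] ++ [seq a p.1 * m p.2 | p <- enum {: I * I}].
have [J [e [n [nP eP en1]]]] := invertible_seq Y.
have e1 j k : im g (e j * a k).
  by apply: eP; rewrite inE mem_cat map_f ?orbT // mem_enum.
have e2 j k l : im g (e j * (a k * m l)).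
  apply: eP; rewrite inE mem_cat; apply/orP; right; apply/orP; right.
  by apply/mapP; exists (k, l); rewrite ?mem_enum.
have /choice[F FP] : forall j, exists h : I -> S,
    (forall i k, im g (h i * a k)) /\ \sum_i h i * a i = e j * n j.
  move=> j; have := nP j; rewrite inE mem_cat => /or3P[/eqP->|/mapP[i0 _ ->]|/mapP[[i0 k0] _ ->]].
  - exists (fun i => e j * m i); split=> [i k|].
      by rewrite -mulrA [m i * _]mulrC.
    by rewrite -am1 mulr_sumr; apply: eq_bigr => i _; rewrite -mulrA [m i * _]mulrC.
  - exists (fun i => if i == i0 then e j else 0); split=> [i k|].
      by case: ifP => // _; rewrite mul0r.
    rewrite (bigD1 i0) //= eqxx big1 ?addr0 // => i /negPf->.
    by rewrite mul0r.
  - exists (fun i => if i == i0 then e j * m k0 else 0); split=> [i k|].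
      by case: ifP => // _; rewrite ?mul0r // -mulrA [m k0 * _]mulrC.
    rewrite (bigD1 i0) //= eqxx big1 ?addr0 => [|i /negPf->].
      by rewrite -mulrA [m k0 * _]mulrC.
    by rewrite mul0r.
exists (fun i => \sum_j F j i); split=> [i k|].
  by rewrite mulr_suml; apply: im_sum => j; have [] := FP j.
rewrite -[RHS]en1; under eq_bigr => i _ do rewrite mulr_suml.
by rewrite exchange_big; apply: eq_bigr => j _; have [] := FP j.
Qed.

(** As 1 is among the generators of the invertible span, the elements of its inverse lie in [A] and
    serve as denominators. *)
Lemma common_denominators (I : finType) (s : I -> S) :
  exists (J : finType) (a : J -> A) (m : J -> S) (c : J -> I -> A),
    (forall j i, g (a j) * s i = g (c j i)) /\ \sum_j g (a j) * m j = 1.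
Proof.
have [J [e [m [mP eP em1]]]] := invertible_seq [seq s i | i <- enum I].
have /choice[a aE] : forall j, exists b, g b = e j.
  by move=> j; have := eP j 1; rewrite mulr1; apply; rewrite inE eqxx.
have /choice[c cE] : forall p : J * I, exists b, g b = g (a p.1) * s p.2.
  move=> [j i] /=; rewrite aE; apply: eP; rewrite inE map_f ?orbT // mem_enum //.
exists J, a, m, (fun j i => c (j, i)); split=> [j i|]; first by rewrite cE.
by rewrite -[RHS]em1; apply: eq_bigr => j _; rewrite aE.
Qed.

Lemma adjoin1_invertible_eqflat : injective g -> eqflat g.
Proof.
move=> ginj I r s rs0.
have [J [a [m [c [cE am1]]]]] := common_denominators s.
exists J, c, m; split=> [j|i].
  apply: ginj; rewrite rmorph0 rmorph_sum -[RHS](mulr0 (g (a j))) -[in RHS]rs0 mulr_sumr.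
  by apply: eq_bigr => i _; rewrite rmorphM -cE mulrCA.
rewrite -[LHS]mul1r -am1 mulr_suml; apply: eq_bigr => j _.
by rewrite -cE mulrAC.
Qed.

End Invertibility.

(** * Intermediate rings of a base change *)

(** With [flat_relations], this is all that is used of the tensor product. Both conditions pass to a
    larger base, over which [P] need not be shown to be a tensor product. *)
Definition spanning (T S P : comPzRingType) (i : {rmorphism T -> P})
    (j : {rmorphism S -> P}) : Prop :=
  forall p, exists l : seq (T * S), p = \sum_(q <- l) i q.1 * j q.2.

(** The conclusion of [eqflat_tensor] for the module [S], with the vanishing read in [P]. *)
Definition flat_relations (A T S P : comPzRingType) (f : {rmorphism A -> T})
    (g : {rmorphism A -> S}) (i : {rmorphism T -> P}) (j : {rmorphism S -> P}) : Prop :=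
  forall (I : finType) (t : I -> T) (s : I -> S),
    \sum_l i (t l) * j (s l) = 0 ->
    gen_span f (fun rho => \sum_l g (rho l) * s l = 0) t.

(* The sum of the [x l (x) y l] is an element of [T (x)_A T] of multiplication 1
   that is killed by each [t k (x) 1 - 1 (x) t k]. *)
Definition locally_separable (A T : comPzRingType) (f : {rmorphism A -> T}) : Prop :=
  forall (K : finType) (t : K -> T), exists (L : finType) (x y : L -> T),
    \sum_l x l * y l = 1 /\
    forall (V : zmodType) (beta : T -> T -> V),
      (forall z z' w, beta (z + z') w = beta z w + beta z' w) ->
      (forall z w w', beta z (w + w') = beta z w + beta z w') ->
      (forall a z w, beta (f a * z) w = beta z (f a * w)) ->
      forall k, \sum_l beta (t k * x l) (y l) = \sum_l beta (x l) (t k * y l).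

Section Core.
Variables (A T S P : comPzRingType) (f : {rmorphism A -> T}) (g : {rmorphism A -> S}).
Variables (i : {rmorphism T -> P}) (j : {rmorphism S -> P}).
Hypothesis ginj : injective g.
Hypothesis ginv : adjoin1_invertible g.
Hypothesis ij : forall a, i (f a) = j (g a).
Hypothesis Pspan : spanning i j.
Hypothesis Pflat : flat_relations f g i j.
Hypothesis Tsep : locally_separable f.

Lemma spanning_family (I : finType) (p : I -> P) :
  exists (L : finType) (t : L -> T) (s : I -> L -> S),
    forall k, p k = \sum_l i (t l) * j (s k l).
Proof.
have /choice[l lE] := fun k => Pspan (p k).
(* The lists chosen for the various [p k] are concatenated, with [S]-coefficient 0 outside the block
   of [k]. *)
pose q (x : {k : I & 'I_(size (l k))}) := tnth (in_tuple (l (tag x))) (tagged x).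
exists {k : I & 'I_(size (l k))}, (fun x => (q x).1),
  (fun k x => if tag x == k then (q x).2 else 0) => k.
pose F (k' : I) (m : 'I_(size (l k'))) : P := i (tnth (in_tuple (l k')) m).1 *
  j (if k' == k then (tnth (in_tuple (l k')) m).2 else 0).
rewrite -(sig_big_dep (J := fun k' => 'I_(size (l k'))) xpredT (fun=> xpredT) F) /= /F.
rewrite (bigD1 k) //= [X in _ + X]big1 ?addr0 => [|k' /negPf->]; last first.
  by rewrite big1 // => m _; rewrite rmorph0 mulr0.
by rewrite lE eqxx [LHS]big_tnth.
Qed.

(** The equation [i t = 0] is read as a relation of [t] with the element 1 of [S]; the resulting
    coefficients die in [S], hence in [A]. *)
Lemma base_injective : injective i.
Proof.
suff i0 t : i t = 0 -> t = 0.
  move=> x y E; apply/eqP; rewrite -subr_eq0; apply/eqP/i0.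
  by rewrite rmorphB E subrr.
move=> it0.
have /Pflat[J [rho [tau [r0 e]]]] : \sum_(l : unit) i t * j 1 = 0.
  by rewrite big1 // => _ _; rewrite it0 mul0r.
rewrite (e tt) big1 // => k _; suff -> : rho k tt = 0 by rewrite rmorph0 mul0r.
apply: ginj; rewrite rmorph0 -(r0 k) (bigD1 tt) //= big1 ?addr0 ?mulr1 //.
Qed.

Section Intermediate.
Variables (U : comPzRingType) (u : {rmorphism U -> P}) (a : {rmorphism T -> U}).
Hypothesis uinj : injective u.
Hypothesis uaE : forall t, u (a t) = i t.

Let af : {rmorphism A -> U} := a \o f.
Let iof : {rmorphism A -> P} := i \o f.

(** A relation in [P] is trivialized twice: first on the side of [T] by [Pflat], then on the side of
    [S], which is flat over [A]. *)
Lemma spanning_eqflat : eqflat iof.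
Proof.
move=> I b p bp0.
have [L [t [s pE]]] := spanning_family p.
have /Pflat[M [rho [tau [r0 e]]]] : \sum_l i (t l) * j (\sum_k g (b k) * s k l) = 0.
  rewrite -[RHS]bp0; under [RHS]eq_bigr => k _ do rewrite pE mulr_sumr.
  rewrite exchange_big; apply: eq_bigr => l _ /=.
  rewrite rmorph_sum mulr_sumr; apply: eq_bigr => k _.
  by rewrite rmorphM /= -ij mulrCA.
pose s' m k := \sum_l g (rho m l) * s k l.
apply: (gen_span_sum (T := fun m k => i (tau m) * j (s' m k))) => [m|k]; last first.
  rewrite pE; under eq_bigr => l _ do rewrite e rmorph_sum mulr_suml.
  rewrite exchange_big; apply: eq_bigr => m _ /=; rewrite rmorph_sum mulr_sumr.
  by apply: eq_bigr => l _; rewrite !rmorphM -ij mulrA [i (tau m) * _]mulrC.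
have /(adjoin1_invertible_eqflat ginv ginj)[Q [sig [om [z e']]]] : \sum_k g (b k) * s' m k = 0.
  rewrite -[RHS](r0 m); under eq_bigr => k _ do rewrite mulr_sumr.
  rewrite exchange_big; apply: eq_bigr => l _ /=; rewrite mulr_sumr.
  by apply: eq_bigr => k _; rewrite mulrCA.
exists Q, sig, (fun q => i (tau m) * j (om q)); split=> // k.
rewrite e' rmorph_sum mulr_sumr; apply: eq_bigr => q _.
by rewrite rmorphM -ij /= mulrCA.
Qed.

Lemma spanning_denominators p : exists (J : finType) (d : J -> A) (m : J -> S) (t : J -> T),
  (forall k, i (f (d k)) * p = i (t k)) /\ \sum_k g (d k) * m k = 1.
Proof.
have [L [t [s pE]]] := spanning_family (fun _ : unit => p).
have [J [d [m [c [cE dm1]]]]] := common_denominators ginv (s tt).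
exists J, d, m, (fun k => \sum_l t l * f (c k l)); split=> // k.
rewrite (pE tt) mulr_sumr rmorph_sum; apply: eq_bigr => l _.
by rewrite ij mulrCA -rmorphM cE -ij rmorphM.
Qed.

(* Terms [p m] outside [U] are eliminated one at a time: the ideal generated by
   the coefficients of [p 0] and by denominators of [p 0] is invertible. *)
Lemma descend_relation (I : finType) (b : I -> A) n (rho : 'I_n -> I -> A)
    (p : 'I_n -> P) (v : I -> U) :
  (forall m, \sum_k b k * rho m k = 0) ->
  (forall k, u (v k) = \sum_m i (f (rho m k)) * p m) ->
  gen_span af (fun r => \sum_k b k * r k = 0) v.
Proof.
elim: n rho p v => [|n IH] rho p v r0 vE.
  by apply: gen_span0 => k; apply: uinj; rewrite vE big_ord0 rmorph0.
have [J [d [m [t [tE dm1]]]]] := spanning_denominators (p ord0).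
pose c := rho ord0.
pose z (x : J + I) := match x with inl k => d k | inr k => c k end.
(* The denominators [d] alone generate the unit ideal of [S], so the coefficients [c] take the
   multiplier 0. *)
have [|e [eP ez1]] := invertible_family ginv (a := fun x => g (z x))
    (m := fun x : J + I => match x with inl k => m k | inr _ => 0 end).
  rewrite big_sumType /= dm1 big1 ?addr0 // => k _.
  by rewrite mulr0.
have /choice[E EE] : forall x : (J + I) * I, exists y, g y = e x.1 * g (c x.2).
  by move=> [x k]; apply: (eP x (inr k)).
have Eb x : \sum_k b k * E (x, k) = 0.
  apply: ginj; rewrite rmorph0 rmorph_sum -[RHS](mulr0 (e x)) -[in RHS](rmorph0 g).
  rewrite -[in RHS](r0 ord0) rmorph_sum mulr_sumr.
  by apply: eq_bigr => k _; rewrite !rmorphM EE mulrCA.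
have Ec k : c k = \sum_k' E (inl k', k) * d k' + \sum_k' E (inr k', k) * c k'.
  apply: ginj; rewrite -[LHS]mulr1 -ez1 big_sumType /= mulrDr rmorphD !rmorph_sum !mulr_sumr.
  by congr (_ + _); apply: eq_bigr => k' _; rewrite rmorphM EE /= mulrCA mulrA.
(* By [Ec], the part [c k] of [p ord0] is a combination of the [d k'], which carry [p ord0] into
   [T], and of the [c k'], whose multiples of [p ord0] occur in the [v k']. Subtracting both
   contributions eliminates [p ord0], and each [E (x, _)] subtracted is itself a relation. *)
pose v' k := v k - \sum_k' af (E (inl k', k)) * a (t k') - \sum_k' af (E (inr k', k)) * v k'.
pose rho' l k := rho (lift ord0 l) k - \sum_k' E (inr k', k) * rho (lift ord0 l) k'.
have v'P : gen_span af (fun r => \sum_k b k * r k = 0) v'.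
  apply: (IH rho' (fun l => p (lift ord0 l))) => [l|k].
    rewrite /rho'; under eq_bigr => k _ do rewrite mulrBr.
    rewrite sumrB r0 sub0r; under eq_bigr => k _ do rewrite mulr_sumr.
    rewrite exchange_big big1 ?oppr0 // => k' _ /=.
    by under eq_bigr => k _ do rewrite mulrA; rewrite -mulr_suml Eb mul0r.
  rewrite /v' !rmorphB !rmorph_sum vE big_ord_recl -/c Ec.
  have -> : \sum_k' u (af (E (inl k', k)) * a (t k')) =
      i (f (\sum_k' E (inl k', k) * d k')) * p ord0.
    rewrite !rmorph_sum mulr_suml; apply: eq_bigr => k' _.
    by rewrite rmorphM !uaE -tE !rmorphM mulrA.
  have -> : \sum_k' u (af (E (inr k', k)) * v k') =
      i (f (\sum_k' E (inr k', k) * c k')) * p ord0 +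
      \sum_l i (f (\sum_k' E (inr k', k) * rho (lift ord0 l) k')) * p (lift ord0 l).
    have -> : \sum_l i (f (\sum_k' E (inr k', k) * rho (lift ord0 l) k')) * p (lift ord0 l) =
        \sum_k' \sum_l i (f (E (inr k', k) * rho (lift ord0 l) k')) * p (lift ord0 l).
      rewrite exchange_big; apply: eq_bigr => l _ /=.
      by rewrite !rmorph_sum mulr_suml.
    rewrite !rmorph_sum mulr_suml -big_split; apply: eq_bigr => k' _ /=.
    rewrite rmorphM uaE vE big_ord_recl mulrDr !rmorphM mulrA; congr (_ + _).
    by rewrite mulr_sumr; apply: eq_bigr => l _; rewrite !rmorphM mulrA.
  rewrite !rmorphD mulrDl opprD !addrA.
  set X := i _ * p ord0; set Y := i _ * p ord0; set Z := \sum_l _; set W := \sum_l _.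
  have -> : X + Y + Z - X - Y - W = Z - W.
    by rewrite -(addrA (X + Y + Z)) -opprD [X + Y + Z]addrC addrK.
  by rewrite -sumrB; apply: eq_bigr => l _; rewrite !rmorphB mulrBl.
apply: (gen_spanD v'P (t2 := fun k => \sum_x af (E (x, k)) *
    match x with inl k' => a (t k') | inr k' => v k' end)) => [|k].
  apply: (gen_span_sum (T := fun x k => af (E (x, k)) *
    match x with inl k' => a (t k') | inr k' => v k' end)) => // x.
  by apply: (gen_span1 (rho := fun k => E (x, k))).
by rewrite big_sumType /= /v' -(addrA (v k)) -opprD subrK.
Qed.

Lemma intermediate_base_eqflat : eqflat af.
Proof.
move=> I b v bv0.
have /spanning_eqflat[J [rho [p [r0 e]]]] : \sum_k iof (b k) * u (v k) = 0.
  rewrite -[RHS](rmorph0 u) -bv0 rmorph_sum; apply: eq_bigr => k _.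
  by rewrite rmorphM uaE.
apply: (descend_relation (rho := fun m => rho (enum_val m)) (p := fun m => p (enum_val m)))
  => [m|k]; first exact: r0.
by rewrite e (reindex _ (onW_bij _ (enum_val_bij J))).
Qed.

(** Separability moves each [r k] across the tensor sign, so that the tensors of [r k * x l] and
    [y l * v k] sum to 0 over [A]. Flatness of [U] over [A] trivializes this sum, and
    [\sum_l x l * y l = 1] recovers [v]. *)
Lemma intermediate_eqflat : eqflat a.
Proof.
move=> I r v rv0.
have [L [x [y [xy1 sep]]]] := Tsep r.
pose n (q : I * L) : restr f := r q.1 * x q.2.
pose w (q : I * L) := a (y q.2) * v q.1.
have /(eqflat_tensor intermediate_base_eqflat)[J [rho [om [r0 e]]]] :
    \sum_q tens af (n q) (w q) = 0.
  rewrite -(pair_big xpredT xpredT (fun k l => tens af (r k * x l : restr f) (a (y l) * v k))) /=.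
  have E k : \sum_l tens af (r k * x l : restr f) (a (y l) * v k) =
      \sum_l tens af (x l : restr f) (a (r k * y l) * v k).
    apply: (sep _ (fun z z' => tens af (z : restr f) (a z' * v k))).
    - by move=> *; apply: tensDl.
    - by move=> *; rewrite rmorphD mulrDl tensDr.
    - move=> b z z'; rewrite rmorphM -mulrA.
      exact: (tensZ af b (z : restr f)).
  under eq_bigr => k _ do rewrite E.
  rewrite exchange_big big1 // => l _ /=.
  have t0 : tens af (x l : restr f) 0 = 0.
    by apply: (addrI (tens af (x l : restr f) 0)); rewrite -tensDr !addr0.
  rewrite -(big_morph _ (@tensDr _ _ af _ (x l : restr f)) t0).
  rewrite -[RHS]t0 -[in RHS](mulr0 (a (y l))) -[in RHS]rv0 mulr_sumr; congr (tens _ _ _).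
  by apply: eq_bigr => k _; rewrite rmorphM mulrCA mulrA.
exists J, (fun q k => \sum_l f (rho q (k, l)) * x l), om; split=> [q|k].
  apply: etrans (r0 q).
  have -> : \sum_k r k * (\sum_l f (rho q (k, l)) * x l) =
      \sum_k \sum_l rho q (k, l) *: (r k * x l : restr f).
    apply: eq_bigr => k _; rewrite mulr_sumr; apply: eq_bigr => l _.
    by rewrite restr_scaleE mulrCA.
  by rewrite pair_big; apply: eq_bigr => -[].
have e' l : a (y l) * v k = \sum_q af (rho q (k, l)) * om q := e (k, l).
rewrite -[LHS]mul1r -(rmorph1 a) -xy1 rmorph_sum mulr_suml.
under eq_bigr => l _ do rewrite rmorphM -mulrA e' mulr_sumr.
rewrite exchange_big; apply: eq_bigr => q _ /=.
rewrite rmorph_sum mulr_suml; apply: eq_bigr => l _.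
by rewrite rmorphM mulrCA mulrA.
Qed.

(** The system [d k * w = t k] is trivialized over [T] as relations between [w] and 1. In each
    solution, the coefficient of 1 times [w] equals the coefficient of [w], since their difference
    is killed by all [d k]; the coefficients of 1 are thus denominators of [w]. *)
Lemma intermediate_weakly_surjective : weakly_surjective a.
Proof.
move=> w.
have [J [d [m [t [tE dm1]]]]] := spanning_denominators (u w).
pose r k b := if b then f (d k) else - t k.
pose v b := if b then w else 1.
have /(eqflat_system intermediate_eqflat)[Q [rho [tau [r0 e]]]] :
    forall k, \sum_b a (r k b) * v b = 0.
  move=> k; rewrite big_bool /= mulr1; apply: uinj.
  by rewrite rmorph0 rmorphD rmorphM !uaE tE rmorphN subrr.
exists Q, (rho ^~ false), (rho ^~ true), tau; split=> [q|]; last by rewrite -(e false).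
apply: uinj; rewrite rmorphM !uaE; apply/eqP; rewrite -subr_eq0; apply/eqP.
set z := _ - _; rewrite -[z]mul1r -(rmorph1 j) -dm1 rmorph_sum mulr_suml big1 // => k _.
suff z0 : i (f (d k)) * z = 0 by rewrite rmorphM -ij mulrAC z0 mul0r.
rewrite /z mulrBr mulrCA tE -!rmorphM -rmorphB.
have := r0 q k; rewrite big_bool /= mulNr => /eqP; rewrite subr_eq0 => /eqP->.
by rewrite mulrC subrr rmorph0.
Qed.

End Intermediate.

Lemma base_change_prufer : prufer i.
Proof.
split=> [|U u a uinj uaE]; first exact: base_injective.
split; first exact/eqflat_flat/(intermediate_eqflat uinj uaE).
exact/weakly_surjective_epi/(intermediate_weakly_surjective uinj uaE).
Qed.

End Core.

(** * Absolutely flat base change *)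

(** Each difference [z k] has multiplication 0; trivializing this relation yields [w k] of
    multiplication 1 killed by [z k]. The product of the [w k] is killed by all [z k] at once. *)
Lemma absolutely_flat_separable (R T : comPzRingType) (f : {rmorphism R -> T}) :
  absolutely_flat f -> locally_separable f.
Proof.
move=> [_ af] K t.
have [_ univ] := rtensor_is_ring_tensor f f.
have [[m [mr ml]] _] := univ T idfun idfun (fun r => erefl).
have mfl := flat_eqflat (af _ _ _ (rtensor_is_ring_tensor f f) m mr ml).
pose z k : rtensor f f := rinl f f (t k) - rinr f f (t k).
have /choice[w wP] : forall k, exists w : rtensor f f, m w = 1 /\ z k * w = 0.
  move=> k; have /mfl[J [rho [tau [r0 e]]]] : \sum_(l : unit) m (z k) * 1 = 0.
    by rewrite big1 // => _ _; rewrite mulr1 rmorphB mr ml subrr.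
  exists (\sum_q rho q tt * rinr f f (tau q)); split.
    by rewrite rmorph_sum (e tt); apply: eq_bigr => q _; rewrite rmorphM mr.
  rewrite mulr_sumr big1 // => q _; rewrite mulrA.
  have := r0 q; rewrite (bigD1 tt) //= big1 ?addr0 => [->|[]] //.
  by rewrite mul0r.
have [l lE] := rtensorP (\prod_k w k).
pose x q := (tnth (in_tuple l) q).1; pose y q := (tnth (in_tuple l) q).2.
exists 'I_(size l), x, y; split=> [|V b bl br ba k].
  have := congr1 m lE; rewrite rmorph_prod big1; last by move=> k _; have [] := wP k.
  move=> ->; rewrite rmorph_sum [RHS]big_tnth; apply: eq_bigr => q _.
  by rewrite rtensE rmorphM mr ml.
have bD := rtliftD bl br ba; have bt := rtlift_tens bl br ba.
have b0 : rtlift b (0 : rtensor f f) = 0.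
  by apply: (addrI (rtlift b (0 : rtensor f f))); rewrite -bD !addr0.
have : rinl f f (t k) * \prod_k w k = rinr f f (t k) * \prod_k w k.
  apply/eqP; rewrite -subr_eq0 -mulrBl (bigD1 k) //= mulrA.
  by have [_ zw] := wP k; rewrite zw mul0r.
rewrite lE !mulr_sumr => /(congr1 (rtlift b)); rewrite !(big_morph _ bD b0) => E.
transitivity (\sum_(q <- l) rtlift b (rinl f f (t k) * rtens f f q.1 q.2)).
  by rewrite [RHS]big_tnth; apply: eq_bigr => q _; rewrite rtensM bt mul1r.
by rewrite E [LHS]big_tnth; apply: eq_bigr => q _; rewrite rtensM bt mul1r.
Qed.

Section RingTensorElements.
Variables (R S T P : comPzRingType) (f : {rmorphism R -> T}) (g : {rmorphism R -> S}).
Variables (i : {rmorphism T -> P}) (j : {rmorphism S -> P}).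
Hypothesis Pten : is_ring_tensor f g i j.

Lemma ring_tensor_spanning : spanning i j.
Proof.
have [ij univ] := Pten; have [rij runiv] := rtensor_is_ring_tensor f g.
have [[h [hi hj]] _] := univ _ _ _ rij.
have [[k [ki kj]] _] := runiv _ _ _ ij.
move=> p; have -> : p = k (h p).
  have [_ /(_ idfun (k \o h : {rmorphism P -> P}))] := univ _ _ _ ij.
  by apply=> //= x; rewrite ?hi ?ki ?hj ?kj.
have [l ->] := rtensorP (h p); exists [seq (q.2, q.1) | q <- l].
rewrite rmorph_sum big_map; apply: eq_bigr => q _.
by rewrite rtensE rmorphM ki kj mulrC.
Qed.

Lemma ring_tensor_flat_relations : flat_morphism f -> flat_relations f g i j.
Proof.
move=> /flat_eqflat fl I t s ts0.
have [ij univ] := Pten; have [rij runiv] := rtensor_is_ring_tensor f g.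
have [[h [hi hj]] _] := univ _ _ _ rij.
apply: (eqflat_tensor (N := restr g) fl (n := s)).
have := congr1 h ts0; rewrite rmorph0 rmorph_sum => E; apply: etrans E.
apply: eq_bigr => l _; rewrite rmorphM hi hj mulrC -rtensE //.
Qed.
End RingTensorElements.

(** * Passage from the base [R] to a base [B] *)

Section BaseChange.
Variables (R S T P B T' : comPzRingType).
Variables (f : {rmorphism R -> T}) (g : {rmorphism R -> S}).
Variables (i : {rmorphism T -> P}) (j : {rmorphism S -> P}).
Variables (b : {rmorphism B -> S}) (k : {rmorphism R -> B}).
Variables (i' : {rmorphism T' -> P}) (c : {rmorphism T -> T'}) (f' : {rmorphism B -> T'}).
Hypothesis bk : forall r, b (k r) = g r.
Hypothesis ij : forall r, i (f r) = j (g r).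
Hypothesis i'inj : injective i'.
Hypothesis i'c : forall t, i' (c t) = i t.
Hypothesis i'f' : forall z, i' (f' z) = j (b z).
Hypothesis T'span : spanning c f'.

Let cf r : c (f r) = f' (k r).
Proof. by apply: i'inj; rewrite i'c i'f' bk ij. Qed.

Lemma base_change_spanning : spanning i j -> spanning i' j.
Proof.
move=> sp p; have [l ->] := sp p; exists [seq (c q.1, q.2) | q <- l].
by rewrite big_map; apply: eq_bigr => q _; rewrite i'c.
Qed.

(** Elements of [T'] are written with coefficients in [B], which are moved to the side of [S].
    Relations over [R] for the new sums, multiplied by those coefficients, are relations over
    [B]. *)
Lemma base_change_flat_relations : flat_relations f g i j -> flat_relations f' b i' j.
Proof.
move=> fl I t s ts0; have [Q [x [z tE]]] := spanning_family T'span t.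
have /fl[M [rho [tau [r0 e]]]] : \sum_q i (x q) * j (\sum_l b (z l q) * s l) = 0.
  rewrite -[RHS]ts0; under [RHS]eq_bigr => l _ do rewrite tE rmorph_sum mulr_suml.
  rewrite exchange_big; apply: eq_bigr => q _ /=; rewrite rmorph_sum mulr_sumr.
  by apply: eq_bigr => l _; rewrite !rmorphM i'c i'f' mulrA.
exists M, (fun m l => \sum_q k (rho m q) * z l q), (fun m => c (tau m)); split=> [m|l].
  rewrite -[RHS](r0 m); under eq_bigr => l _ do rewrite rmorph_sum mulr_suml.
  rewrite exchange_big; apply: eq_bigr => q _ /=; rewrite mulr_sumr.
  by apply: eq_bigr => l _; rewrite rmorphM bk mulrA.
rewrite tE; under eq_bigr => q _ do rewrite e rmorph_sum mulr_suml.
rewrite exchange_big; apply: eq_bigr => m _ /=; rewrite rmorph_sum mulr_suml.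
by apply: eq_bigr => q _; rewrite !rmorphM cf mulrAC.
Qed.

(** The separating element found for generators [x] from [T] also works in [T'], because
    coefficients from [B] cross the tensor sign over [B]. *)
Lemma base_change_separable : locally_separable f -> locally_separable f'.
Proof.
move=> sep K t; have [Q [x [z tE]]] := spanning_family T'span t.
have [L [u [v [uv1 uvP]]]] := sep Q x.
exists L, (fun l => c (u l)), (fun l => c (v l)); split=> [|V be bl br ba n].
  by rewrite -[RHS](rmorph1 c) -uv1 rmorph_sum; apply: eq_bigr => l _; rewrite rmorphM.
have be0l w : be 0 w = 0 by apply: (addrI (be 0 w)); rewrite -bl !addr0.
have be0r w : be w 0 = 0 by apply: (addrI (be w 0)); rewrite -br !addr0.
have blS w : {morph be^~ w : y y' / y + y'} by move=> y y'; apply: bl.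
rewrite tE; under eq_bigr => l _ do rewrite mulr_suml (big_morph _ (blS _) (be0l _)).
under [RHS]eq_bigr => l _ do rewrite mulr_suml (big_morph _ (br _) (be0r _)).
rewrite exchange_big [RHS]exchange_big; apply: eq_bigr => q _ /=.
transitivity (\sum_l be (c (x q * u l)) (f' (z n q) * c (v l))).
  by apply: eq_bigr => l _; rewrite -ba rmorphM mulrAC mulrC.
rewrite (uvP V (fun y y' => be (c y) (f' (z n q) * c y'))).
- by apply: eq_bigr => l _; rewrite rmorphM mulrA [f' _ * _]mulrC.
- by move=> *; rewrite rmorphD bl.
- by move=> *; rewrite rmorphD mulrDr br.
- by move=> r y y'; rewrite !rmorphM cf ba mulrCA.
Qed.

End BaseChange.

(** Gives access to [integralOver], which is stated over nonzero rings. *)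
Lemma comNzRing_of (R : comPzRingType) : (1 : R) <> 0 ->
  exists R' : comNzRingType, R = R' :> comPzRingType.
Proof.
move=> /eqP R1.
pose m := GRing.PzSemiRing_isNonZero.Build R R1.
pose R' : comNzRingType := HB.pack (GRing.ComPzRing.sort R) m.
by exists R'; rewrite /R'; clear; case: R R1 m.
Qed.

(** * Integral closure *)

Lemma integral_overE (R S : comNzRingType) (g : {rmorphism R -> S}) y :
  integral_over g y <-> integralOver g y.
Proof.
split=> [[n [c E]]|[p /monicP p1 /rootP E]].
  pose q : {poly R} := \poly_(k < n) (if insub k is Some l then c l else 0).
  exists ('X^n + q).
    by apply/monicP; rewrite lead_coefDl ?lead_coefXn // size_polyXn ltnS size_poly.
  apply/rootP; rewrite rmorphD /= map_polyXn hornerD hornerXn -[RHS]E; congr (_ + _).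
  rewrite (horner_coef_wide (n := n)); last by rewrite (leq_trans (size_poly _ _)) ?size_poly.
  by apply: eq_bigr => k _; rewrite coef_map /= coef_poly ltn_ord valK.
have p0 : p != 0 by apply/eqP => p0; move: p1; rewrite p0 lead_coef0 => /eqP; rewrite eq_sym oner_eq0.
have sp : size p = (size p).-1.+1 by rewrite prednK // size_poly_gt0.
exists (size p).-1, (fun k => p`_k); rewrite -[RHS]E.
rewrite (horner_coef_wide (n := (size p).-1.+1)); last by rewrite -sp size_poly.
rewrite big_ord_recr /= addrC; congr (_ + _).
  by rewrite coef_map /= -lead_coefE p1 rmorph1 mul1r.
by apply: eq_bigr => k _; rewrite coef_map.
Qed.

Section IntegralClosure.
Variables (R S : comPzRingType) (g : {rmorphism R -> S}).

Lemma integral_over_im r : integral_over g (g r).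
Proof. by exists 1%N, (fun=> - r); rewrite big_ord1 expr1 mulr1 rmorphN subrr. Qed.

(** [F] is quantified over the rings so that equalities of ring structures can be rewritten in it;
    [S] nonzero forces [R] nonzero. *)
Lemma nonzero_ring_ind (F : forall (R S : comPzRingType), {rmorphism R -> S} -> Prop) :
  (forall (R' S' : comNzRingType) (h : {rmorphism R' -> S'}), F R' S' h) ->
  ((1 : S) = 0 -> F R S g) -> F R S g.
Proof.
move=> FN F0; have [S1|S1] := pselect ((1 : S) = 0); first exact: F0.
have R1 : (1 : R) <> 0 by move=> R1; apply: S1; rewrite -(rmorph1 g) R1 rmorph0.
move: (comNzRing_of S1) (comNzRing_of R1) g => [S' ES] [R' ER].
by rewrite ES ER.
Qed.

Lemma integral_over_subring : (forall y z, integral_over g y -> integral_over g z ->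
  integral_over g (y - z) /\ integral_over g (y * z)).
Proof.
apply: (nonzero_ring_ind (F := fun R S g => forall y z, integral_over g y ->
  integral_over g z -> integral_over g (y - z) /\ integral_over g (y * z))).
  move=> R' S' h y z /integral_overE yi /integral_overE zi.
  by split; apply/integral_overE; [exact: integral_sub | exact: integral_mul].
(* In the zero ring everything satisfies the equation of degree 0. *)
move=> S1 y z _ _; have I0 t : integral_over g t.
  by exists 0%N, (fun=> 0); rewrite big_ord0 addr0.
by split.
Qed.

Fact integral_over1 : integral_over g 1.
Proof. by rewrite -(rmorph1 g); apply: integral_over_im. Qed.
Fact integral_overB y z : integral_over g y -> integral_over g z -> integral_over g (y - z).
Proof. by move=> yi zi; have [] := integral_over_subring yi zi. Qed.
Fact integral_overM y z : integral_over g y -> integral_over g z -> integral_over g (y * z).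
Proof. by move=> yi zi; have [] := integral_over_subring yi zi. Qed.

Definition integral_closure := Subring integral_over1 integral_overB integral_overM.

End IntegralClosure.

Section Compositum.
Variables (T B P : comPzRingType) (i : {rmorphism T -> P}) (h : {rmorphism B -> P}).

(** The image in [P] of the tensor product of [T] and [B]. *)
Definition compositum_mem (p : P) : Prop :=
  exists l : seq (T * B), p = \sum_(q <- l) i q.1 * h q.2.

Fact compositum1 : compositum_mem 1.
Proof. by exists [:: (1, 1)]; rewrite big_seq1 !rmorph1 mulr1. Qed.
Fact compositumB x y : compositum_mem x -> compositum_mem y -> compositum_mem (x - y).
Proof.
move=> [l ->] [l' ->]; exists (l ++ [seq (- q.1, q.2) | q <- l']).
rewrite big_cat big_map -sumrN; congr (_ + _); apply: eq_bigr => q _.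
by rewrite rmorphN mulNr.
Qed.
Fact compositumM x y : compositum_mem x -> compositum_mem y -> compositum_mem (x * y).
Proof.
move=> [l ->] [l' ->]; exists [seq (q.1 * q'.1, q.2 * q'.2) | q <- l, q' <- l'].
rewrite big_allpairs_dep mulr_suml; apply: eq_bigr => q _.
by rewrite mulr_sumr; apply: eq_bigr => q' _; rewrite !rmorphM mulrACA.
Qed.
Definition compositum := Subring compositum1 compositumB compositumM.
End Compositum.

Lemma integral_over_morph (A B S P : comPzRingType) (g : {rmorphism A -> S})
    (h : {rmorphism B -> P}) (c : {rmorphism A -> B}) (j : {rmorphism S -> P}) y :
  (forall a, h (c a) = j (g a)) -> integral_over g y -> integral_over h (j y).
Proof.
move=> hc [n [d E]]; exists n, (fun k => c (d k)).
rewrite -[RHS](rmorph0 j) -[in RHS]E rmorphD rmorphXn rmorph_sum; congr (_ + _).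
by apply: eq_bigr => k _; rewrite hc rmorphM rmorphXn.
Qed.

Theorem theorem3p14 (R S T : comPzRingType)
    (g : {rmorphism R -> S}) (f : {rmorphism R -> T}) :
  absolutely_flat f ->
  forall (P : comPzRingType) (i : {rmorphism T -> P}) (j : {rmorphism S -> P}),
    is_ring_tensor f g i j ->
    (prufer g -> prufer i) /\ (quasi_prufer g -> quasi_prufer i).
Proof.
move=> fab P i j Pt.
have ij := Pt.1.
have sep := absolutely_flat_separable fab.
have span := ring_tensor_spanning Pt.
have rel := ring_tensor_flat_relations Pt fab.1.
split=> [gP|[ginj gQ]].
  exact: (base_change_prufer gP.1 (prufer_adjoin1_invertible gP) ij span rel sep).
split; first exact: base_injective ginj rel.
pose B := subring_of (integral_closure g).
pose b : {rmorphism B -> S} := val.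
have binj : injective b := val_inj.
have [k bk] : exists k : {rmorphism R -> B}, forall r, b (k r) = g r.
  apply: corestriction => // r.
  by have [y yE] := subring_valK (V := integral_closure g) (integral_over_im g r); exists y.
have bP : prufer b.
  apply: (gQ B b k binj bk) => y; split=> [[z <-]|]; first exact: (subring_valP z).
  by move/(subring_valK (V := integral_closure g))=> [z zE]; exists z.
(* The argument of the Prüfer case over the base [B], for any subring of [P] generated by [T] and
   [B]. It serves first for the compositum [C] and then for the integral closure [A']. *)
have base_prufer (T' : comPzRingType) (i' : {rmorphism T' -> P}) (c : {rmorphism T -> T'})
    (f' : {rmorphism B -> T'}) : injective i' -> (forall t, i' (c t) = i t) ->
    (forall z, i' (f' z) = j (b z)) -> spanning c f' -> prufer i'.
  move=> i'inj i'c i'f' sp.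
  apply: (base_change_prufer (f := f') (g := b) (j := j) binj (prufer_adjoin1_invertible bP) i'f').
  - exact: base_change_spanning i'c span.
  - exact: base_change_flat_relations bk ij i'inj i'c i'f' sp rel.
  - exact: base_change_separable bk ij i'inj i'c i'f' sp sep.
move=> A' i' c i'inj i'c i'P.
pose jb : {rmorphism B -> P} := j \o b.
pose C := subring_of (compositum i jb).
pose iC : {rmorphism C -> P} := val.
have iCinj : injective iC := val_inj.
have inC p : compositum_mem i jb p -> exists y, iC y = p.
  by move/(subring_valK (V := compositum i jb))=> [z zE]; exists z.
have [c1 c1E] : exists c1 : {rmorphism T -> C}, forall t, iC (c1 t) = i t.
  apply: corestriction => // t; apply: inC.
  by exists [:: (t, 1)]; rewrite big_seq1 rmorph1 mulr1.
have [f1 f1E] : exists f1 : {rmorphism B -> C}, forall z, iC (f1 z) = jb z.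
  apply: corestriction => // z; apply: inC.
  by exists [:: (1, z)]; rewrite big_seq1 rmorph1 mul1r.
have CP : prufer iC.
  apply: (base_prufer _ _ c1 f1) => // y.
  have [l lE] := subring_valP y; exists l; apply: iCinj; rewrite [LHS]lE rmorph_sum.
  by apply: eq_bigr => q _; rewrite rmorphM c1E f1E.
(* Elements of [B] are integral over [R], so their images are integral over [T] and lie in [A']. *)
have [f' i'f'] : exists f' : {rmorphism B -> A'}, forall z, i' (f' z) = jb z.
  apply: corestriction => // z; apply/i'P.
  exact: (integral_over_morph ij (subring_valP z)).
(* It remains to see that [T] and [B] generate [A']: its elements are integral over [T], hence over
   [C], which is integrally closed in [P]. *)
apply: (base_prufer _ _ c f') => // y.
have : integral_over iC (i' y).
  apply: (integral_over_morph (g := i) (c := c1) (j := idfun)) => //.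
  by apply/i'P; exists y.
move/(prufer_integrally_closed CP)=> [z zE].
have [l lE] := subring_valP z; exists l; apply: i'inj; rewrite -zE [LHS]lE rmorph_sum.
by apply: eq_bigr => q _; rewrite rmorphM i'c i'f'.
Qed.
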